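(* Let $\alpha,\beta\in(0,2\wedge d)$. Let $f,g:\mathbb{R}^d\times[0,\infty)\times[0,\infty)\to[0,\infty)$ be continuous with $f(\cdot,0,0)=g(\cdot,0,0)=0$ and such that, for every fixed $x$, $f(x,\cdot,\cdot)$ and $g(x,\cdot,\cdot)$ are component-wise non-decreasing. Suppose that for some $p_2,q_1\ge0$, $p_1,q_2\ge1$ and some measurable $U,V:\mathbb{R}^d\to(0,\infty)$ we have $$\liminf_{(t,s)\to(0+,0+)}\inf_{x\in\mathbb{R}^d}\frac{f(x,t,s)}{U(x)t^{p_1}s^{p_2}}>0,\qquad \liminf_{(t,s)\to(0+,0+)}\inf_{x\in\mathbb{R}^d}\frac{g(x,t,s)}{V(x)t^{q_1}s^{q_2}}>0.$$ Suppose that $$\lim_{r\to\infty}\max\left\{\frac{r^{d-\alpha}}{\Phi_U^{1/p_1}(r)},\ \frac{r^{d-\beta}}{\Phi_V^{1/q_2}(r)},\ \frac{r^{(p_1+p_2+q_1+q_2)d}}{r^{\alpha(p_1+q_1)}r^{\beta(p_2+q_2)}}\frac{1}{\Phi_U(r)\Phi_V(r)}\right\}=0.$$ Then the system $$(-\Delta)^{\alpha/2}u\ge f(x,u,v)\ \text{ in }\mathbb{R}^d,\qquad (-\Delta)^{\beta/2}v\ge g(x,u,v)\ \text{ in }\mathbb{R}^d,\qquad u,v\ge0\ \text{ in }\mathbb{R}^d$$ has only trivial (classical) super-solutions, i.e. for every such $(u,v)$ either $u=0$ in $\mathbb{R}^d$ or $v=0$ in $\mathbb{R}^d$.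
   Context: $d\ge1$; $B(x,r)$ is the ball of radius $r$ centered at $x$. For $\alpha\in(0,2)$, $(-\Delta)^{\alpha/2}u(x)=c_{d,\alpha}\,\mathrm{P.V.}\int_{\mathbb{R}^d}\frac{u(x)-u(y)}{|x-y|^{d+\alpha}}\,dy$ is the fractional Laplacian, with the usual normalizing constant $c_{d,\alpha}>0$. For $U,V:\mathbb{R}^d\to(0,\infty)$ define $$\Phi_U(r)=\inf_{\frac r2\le|x|\le\frac{3r}2}\int_{B(x,r/4)}U(y)\,dy,\qquad \Phi_V(r)=\inf_{\frac r2\le|x|\le\frac{3r}2}\int_{B(x,r/4)}V(y)\,dy,$$ and write $\Phi_U^{a}(r)=(\Phi_U(r))^a$, and similarly for $V$. Super-solutions are classical: $u\in\mathcal{C}^{\alpha+}(\mathbb{R}^d)\cap L^1(\mathbb{R}^d,\omega_\alpha)$ and $v\in\mathcal{C}^{\beta+}(\mathbb{R}^d)\cap L^1(\mathbb{R}^d,\omega_\beta)$, both continuous, with the inequalities holding pointwise. Here $h\in\mathcal{C}^{\alpha+}(D)$ means that for every compact $K\Subset D$ there is $\gamma>0$ with $h\in\mathcal{C}^{\alpha+\gamma}(K)$, and $L^1(\mathbb{R}^d,\omega_\alpha)$ is the class of functions integrable with respect to the weight $\omega_\alpha(x)=\frac{1}{1+|x|^{d+\alpha}}$. *)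

(* Defs.v *)
From HB Require Import structures.
From mathcomp Require Import all_boot all_order all_algebra.
From mathcomp Require Import all_classical all_reals all_analysis.

Set Implicit Arguments.
Unset Strict Implicit.
Unset Printing Implicit Defensive.

Import Order.TTheory GRing.Theory Num.Theory.
Import numFieldNormedType.Exports.

Local Open Scope classical_set_scope.
Local Open Scope ring_scope.

(** Lebesgue measure on R^n is the Caratheodory completion of the n-fold product
    of the one-dimensional Lebesgue measure, transported from n.-tuple R to
    'rV[R]_n.  The sigma-algebra put on 'rV[R]_n is the one of all
    Caratheodory-measurable sets, so that [measurable] and [measurable_fun]
    there mean Lebesgue (not just Borel) measurability. *)

Section cons_measure.
Context {R : realType} (n : nat).
Local Notation T := (measurableTypeR R).
Variable m : {sigma_finite_measure set (n.-tuple T) -> \bar R}.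

Definition consT (p : T * n.-tuple T) : n.+1.-tuple T := [tuple of p.1 :: p.2].

Lemma measurable_consT : measurable_fun setT consT.
Proof. exact: (measurable_cons measurable_fst measurable_snd). Qed.

Definition cons_measure : set (n.+1.-tuple T) -> \bar R :=
  pushforward (lebesgue_measure \x m)%E consT.

Let cons_measure0 : cons_measure set0 = 0%E.
Proof. by rewrite /cons_measure /pushforward preimage_set0 measure0. Qed.

Let cons_measure_ge0 A : (0 <= cons_measure A)%E.
Proof. exact: (measure_ge0 (lebesgue_measure \x m)%E). Qed.

Let cons_measure_sigma_additive : semi_sigma_additive cons_measure.
Proof.
move=> F mF tF mUF; rewrite /cons_measure /pushforward preimage_bigcup.
apply: measure_semi_sigma_additive.
- by move=> k; rewrite -[X in measurable X]setTI; exact: measurable_consT.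
- apply/trivIsetP => i j _ _ ij; rewrite -preimage_setI.
  by move/trivIsetP : tF => /(_ _ _ _ _ ij) ->//; rewrite preimage_set0.
- by rewrite -preimage_bigcup -[X in measurable X]setTI; exact: measurable_consT.
Qed.

HB.instance Definition _ := isMeasure.Build _ _ _ cons_measure
  cons_measure0 cons_measure_ge0 cons_measure_sigma_additive.

Let unconsT (t : n.+1.-tuple T) : T * n.-tuple T :=
  (tnth t ord0, [tuple of behead t]).

Let measurable_unconsT : measurable_fun setT unconsT.
Proof.
apply/measurable_fun_pairP; split.
- exact: measurable_tnth.
- exact: measurable_behead.
Qed.

Let cons_measure_sigma_finite : sigma_finite setT cons_measure.
Proof.
have /sigma_finiteP[F [TF ndF Foo]] := sigma_finiteT (@lebesgue_measure R).
have /sigma_finiteP[G [TG ndG Goo]] := sigma_finiteT m.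
exists (fun k => unconsT @^-1` (F k `*` G k)).
  apply/seteqP; split => // t _.
  have [k _ Fk] : (\bigcup_i F i) (unconsT t).1 by rewrite -TF.
  have [l _ Gl] : (\bigcup_i G i) (unconsT t).2 by rewrite -TG.
  exists (maxn k l) => //; split.
  - by move: Fk; apply/subsetPset/ndF/leq_maxl.
  - by move: Gl; apply/subsetPset/ndG/leq_maxr.
move=> k; have [mF Fk] := Foo k; have [mG Gk] := Goo k; split.
  rewrite -[X in measurable X]setTI; apply: measurable_unconsT => //.
  exact: measurableX.
rewrite /cons_measure /pushforward -comp_preimage.
rewrite (_ : unconsT \o consT = id) ?preimage_id; last first.
  apply/funext => -[x t]; rewrite /unconsT /consT /=; congr pair.
  exact/val_inj.
by rewrite product_measure1E// lte_mul_pinfty// ge0_fin_numE.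
Qed.

HB.instance Definition _ := @Measure_isSigmaFinite.Build _ _ _ cons_measure
  cons_measure_sigma_finite.

End cons_measure.

Fixpoint lebesgue_tuple (R : realType) (n : nat) :
    {sigma_finite_measure set (n.-tuple (measurableTypeR R)) -> \bar R} :=
  match n with
  | 0 => \d_([tuple] : 0.-tuple (measurableTypeR R))
  | n'.+1 => cons_measure (lebesgue_tuple R n')
  end.

Section lebesgue_rV.
Context {R : realType} {n : nat}.

Definition lebesgue_rV (A : set 'rV[R]_n) : \bar R :=
  ((lebesgue_tuple R n)^*)%mu [set t | A (\row_i tnth t i)].

Let lebesgue_rV0 : lebesgue_rV set0 = 0%E.
Proof. exact: outer_measure0. Qed.

Let lebesgue_rV_ge0 A : (0 <= lebesgue_rV A)%E.
Proof. exact: outer_measure_ge0. Qed.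

Let le_lebesgue_rV : {homo lebesgue_rV : A B / A `<=` B >-> (A <= B)%E}.
Proof. by move=> A B AB; apply: le_outer_measure => t; exact: AB. Qed.

Let lebesgue_rV_sigma_subadditive : sigma_subadditive lebesgue_rV.
Proof.
move=> F.
exact: (outer_measure_sigma_subadditive ((lebesgue_tuple R n)^*)%mu
  (fun k => [set t : n.-tuple (measurableTypeR R) | F k (\row_i tnth t i)])).
Qed.

HB.instance Definition _ := isOuterMeasure.Build R _ lebesgue_rV
  lebesgue_rV0 lebesgue_rV_ge0 le_lebesgue_rV lebesgue_rV_sigma_subadditive.

End lebesgue_rV.

Definition rV_display : measure_display. Proof. exact: default_measure_display. Qed.

HB.instance Definition _ (R : realType) (n : nat) :=
  @isMeasurable.Build rV_display 'rV[R]_n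
    (@lebesgue_rV R n).-caratheodory
    (caratheodory_measurable_set0 (@lebesgue_rV R n))
    (@caratheodory_measurable_setC _ _ (@lebesgue_rV R n))
    (@caratheodory_measurable_bigcup _ _ (@lebesgue_rV R n)).

HB.instance Definition _ (R : realType) (n : nat) :=
  isMeasure.Build _ 'rV[R]_n R (@lebesgue_rV R n)
    (outer_measure0 _) (outer_measure_ge0 _)
    (@caratheodory_measure_sigma_additive _ _ (@lebesgue_rV R n)).

Section statement_notions.
Context {R : realType} {d : nat}.
Implicit Types (x y : 'rV[R]_d) (h U : 'rV[R]_d -> R) (K : set 'rV[R]_d).

(** The library norm `|x| on 'rV[R]_d is the sup norm. *)
Definition enorm x : R := Num.sqrt (\sum_(i < d) x ord0 i ^+ 2).

Definition eball x (r : R) : set 'rV[R]_d := [set y | enorm (y - x) < r].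

Definition Gamma (z : R) : R :=
  \int[lebesgue_measure]_(t in `]0, +oo[) (t `^ (z - 1) * expR (- t)).

(** c_{d,a} = 2^a Gamma((d+a)/2) / (pi^{d/2} |Gamma(-a/2)|), where
    |Gamma(-a/2)| = (2/a) Gamma(1-a/2) avoids analytic continuation. *)
Definition frac_laplacian_cst (a : R) : R :=
  a * 2 `^ (a - 1) * Gamma ((d%:R + a) / 2) /
  (pi `^ (d%:R / 2) * Gamma (1 - a / 2)).

(** [lim] is total; for h in C^{a+} and in the weighted L^1 class below, the
    principal value limit does exist. *)
Definition frac_laplacian (a : R) h x : R :=
  frac_laplacian_cst a *
  lim ((\int[lebesgue_rV]_(y in [set y | eps < enorm (x - y)])
          ((h x - h y) / enorm (x - y) `^ (d%:R + a))) @[eps --> 0^'+]).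

(** h is k times differentiable at the points of K, with k-th order partial
    derivatives t-Hoelder continuous on K.  (The lower order derivatives are
    then continuous, hence bounded on K when K is compact.) *)
Fixpoint holder_deriv (k : nat) (t : R) h K : Prop :=
  match k with
  | 0 => exists C : R,
      forall x y, K x -> K y -> `|h x - h y| <= C * enorm (x - y) `^ t
  | k'.+1 => (forall x, K x -> differentiable h x) /\
      forall i : 'I_d, holder_deriv k' t ('D_(delta_mx ord0 i) h) K
  end.

(** C^s(K) for real s > 0; s = k + t with k : nat and t \in ]0, 1] in a unique
    way. *)
Definition holder (s : R) h K : Prop :=
  exists k (t : R), [/\ 0 < t <= 1, s = k%:R + t & holder_deriv k t h K].

Definition holder_plus (a : R) h : Prop :=
  forall K, compact K -> exists2 g : R, 0 < g & holder (a + g) h K.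

Definition weight (a : R) x : R := (1 + enorm x `^ (d%:R + a))^-1.

Definition L1_weight (a : R) h : Prop :=
  lebesgue_rV.-integrable setT (EFin \o (fun x => h x * weight a x)).

(** Extended real valued: U need not be locally integrable.  In quotients by
    [Phi], the library's conventions are 1/0 = +oo and 1/+oo = 0. *)
Definition Phi U (r : R) : \bar R :=
  ereal_inf [set (\int[lebesgue_rV]_(y in eball x (r / 4)) (U y)%:E)%E
            | x in [set x | r / 2 <= enorm x <= 3 * r / 2]].

(** f : R^d x [0,+oo[ x [0,+oo[ -> [0,+oo[; only the values of f at nonnegative
    second and third arguments are constrained. *)
Definition nonlinearity (f : 'rV[R]_d -> R -> R -> R) : Prop :=
  [/\ forall x t s, 0 <= t -> 0 <= s -> 0 <= f x t s,
      {within [set p : 'rV[R]_d * R * R | 0 <= p.1.2 /\ 0 <= p.2],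
        continuous (fun p => f p.1.1 p.1.2 p.2)},
      forall x, f x 0 0 = 0,
      forall x t t' s, 0 <= t -> t <= t' -> 0 <= s -> f x t s <= f x t' s &
      forall x t s s', 0 <= t -> 0 <= s -> s <= s' -> f x t s <= f x t s'].

Definition liminf_pos (f : 'rV[R]_d -> R -> R -> R) U (p q : R) : Prop :=
  (0 < limf_einf
    (fun ts : R * R => ereal_inf
       [set (f x ts.1 ts.2 / (U x * ts.1 `^ p * ts.2 `^ q))%:E | x in setT])
    (filter_prod 0^'+ 0^'+))%E.

Definition classical (a : R) h : Prop :=
  [/\ continuous h, holder_plus a h & L1_weight a h].

Definition supersolution (a b : R) (f g : 'rV[R]_d -> R -> R -> R)
    (u v : 'rV[R]_d -> R) : Prop :=
  [/\ classical a u, classical b v,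
      forall x, f x (u x) (v x) <= frac_laplacian a u x,
      forall x, g x (u x) (v x) <= frac_laplacian b v x &
      forall x, 0 <= u x /\ 0 <= v x].

End statement_notions.

(* Main.v *)
(** A nonnegative super-solution of [(-Delta)^{a/2} u >= G >= 0] satisfies
      [\int_{B_r} G <= C r^{d-a} \inf_{B_r} u].
    Indeed, testing the equation against the paraboloid cap
    [max(0, 1 - |x|^2/(2r)^2)] bounds the left-hand side by
    [C r^{-a} \int_{B_{2r}} u]; the cap is only semiconvex, but a one-sided
    second difference estimate is all that is needed, and far from its support its
    fractional Laplacian is nonpositive.  Touching [u] from below by a multiple of
    the same cap gives the weak Harnack inequality
    [\int_{B_{2r}} u <= C r^d \inf_{B_r} u].

    If [u] and [v] are both nontrivial, they are positive, and with
    [A = min(delta, \inf_{B_{2r}} u)], [B = min(delta, \inf_{B_{2r}} v)] the estimate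
    reads [A^{p1} B^{p2} Phi_U(r) <= C r^{d-alpha} A] and
    [B^{q2} A^{q1} Phi_V(r) <= C r^{d-beta} B].  Multiplying, and using the growth
    bounds [A >= c r^{alpha-d}], [B >= c r^{beta-d}] (the same estimate with a source
    supported in the unit ball), bounds [Phi_U Phi_V] by a multiple of the numerator
    of the third quantity in the limit, which is absurd. *)

Require Import Defs.
From HB Require Import structures.
From mathcomp Require Import all_boot all_order all_algebra.
From mathcomp Require Import all_classical all_reals all_analysis.
From mathcomp Require Import measurable_realfun.
From mathcomp Require Import ring lra.

Set Implicit Arguments.
Unset Strict Implicit.
Unset Printing Implicit Defensive.

Import Order.TTheory GRing.Theory Num.Theory.
Import numFieldNormedType.Exports.

Local Open Scope classical_set_scope.
Local Open Scope ring_scope.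

(** * The product Lebesgue measure *)

(** The operator is a principal value and the cap has a kink on its boundary sphere, so the formal
    integration by parts is not carried out on the operator itself. The kernel is cut off at
    distance [e] instead: its mass, and its mean against [u], are then finite at every point, it is
    symmetric in its two arguments, and moving it from [u] to the cap is Tonelli's theorem. The
    Hoelder class enters only to show that the truncations converge uniformly on balls, so that a
    super-solution inequality passes to the truncated operator up to an error [delta]. The bounds
    that survive as [e] tends to 0 are uniform in [e].

    Cancellation near the diagonal comes from the reflection y -> 2x - y, which preserves both the
    kernel around x and the measure; this is why reflections of Lebesgue measure are studied.

    The minimum with [delta] is forced, since [f] and [g] are bounded below only for small positive
    arguments. Replacing the infimum by the minimum on the right-hand side as well costs a factor
    [max(1, u(0)/delta)], uniform in [r] because the infimum over a ball about 0 is at most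
    [u(0)]. *)

Section lebesgue_tuple.
Context {R : realType}.
Local Notation T := (measurableTypeR R).

(** The reflection pulls []a, b]] back to [[c - b, c - a[], of the same length, and Lebesgue measure
    is determined by its values on half-open intervals. *)
Lemma lebesgue_measure_reflect (c : R) (A : set R) : measurable A ->
  lebesgue_measure ((fun x : T => c - x : T) @^-1` A) = lebesgue_measure A.
Proof.
have mr : measurable_fun setT (fun x : T => c - x : T).
  by apply: measurable_funB => //; exact: measurable_cst.
move=> mA; apply/esym.
pose m := pushforward (@lebesgue_measure R) (fun x : T => c - x : T).
rewrite -[RHS]/(m A).
apply: (lebesgue_measure_unique (mu := m)) => // _ [[a b]] _ <-.
transitivity (lebesgue_measure `[c - b, c - a[%classic).
  rewrite !lebesgue_measure_itv/= !lte_fin.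
  by rewrite ltrD2l ltrN2; case: ifP => // _; rewrite -!EFinB; congr EFin; ring.
rewrite /m /pushforward; congr (lebesgue_measure _).
by apply/seteqP; split => x /=; rewrite !in_itv/= => /andP[? ?]; apply/andP; split; lra.
Qed.

Definition tuple_reflect n (c t : n.-tuple T) : n.-tuple T :=
  [tuple tnth c i - tnth t i | i < n].

Lemma measurable_tuple_reflect n (c : n.-tuple T) :
  measurable_fun setT (tuple_reflect c).
Proof.
apply/measurable_fun_tnthP => i.
rewrite (_ : _ \o _ = fun t => tnth c i - tnth t i); last first.
  by apply/funext => t /=; rewrite tnth_mktuple.
by apply: measurable_funB; [exact: measurable_cst|exact: measurable_tnth].
Qed.

(** Through [consT] the reflection becomes a product of reflections, so by induction its pushforward
    agrees with the product measure on rectangles, and uniqueness of the product measure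
    concludes. *)
Lemma lebesgue_tuple_reflect n (c : n.-tuple T) A : measurable A ->
  lebesgue_tuple R n (tuple_reflect c @^-1` A) = lebesgue_tuple R n A.
Proof.
elim: n c A => [|n IH] c A mA.
  have e (s t : 0.-tuple T) : s = t by rewrite (tuple0 s) (tuple0 t).
  by congr (_ _); apply/funext => t; rewrite /preimage/= (e (tuple_reflect c t) t).
rewrite /= /cons_measure /pushforward.
set m := lebesgue_tuple R n.
pose c' : n.-tuple T := [tuple of behead c].
pose phi (p : T * n.-tuple T) : T * n.-tuple T :=
  (tnth c ord0 - p.1, tuple_reflect c' p.2).
have mphi : measurable_fun setT phi.
  apply/measurable_fun_pairP; split; rewrite /phi.
    by apply: measurable_funB; [exact: measurable_cst|exact: measurable_fst].
  exact: (measurableT_comp (measurable_tuple_reflect c') measurable_snd).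
have -> : @consT R n @^-1` (tuple_reflect c @^-1` A) =
    phi @^-1` (@consT R n @^-1` A).
  apply/funext => -[x t]; rewrite /preimage/=; congr A.
  apply/eq_from_tnth => i; rewrite tnth_mktuple.
  rewrite /consT/= /phi /=.
  case: (unliftP ord0 i) => [j ->|->].
    rewrite !tnthS tnth_mktuple; congr (_ - _).
    by rewrite tnth_behead; congr tnth; apply/val_inj; rewrite /= inordK// ltnS.
  by rewrite !tnth0.
have mB : measurable (@consT R n @^-1` A).
  by rewrite -[X in measurable X]setTI; exact: measurable_consT.
rewrite -[LHS]/(pushforward (lebesgue_measure \x m)%E phi (@consT R n @^-1` A)).
apply/esym.
apply: (product_measure_unique
  (m' := pushforward (lebesgue_measure \x m)%E phi)) => // B C mB' mC.
transitivity ((lebesgue_measure \x m)%E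
  (((fun x : T => tnth c ord0 - x : T) @^-1` B) `*` (tuple_reflect c' @^-1` C))); first by [].
rewrite product_measure1E//.
- by congr (_ * _)%E; [exact: lebesgue_measure_reflect|exact: IH].
- rewrite -[X in measurable X]setTI.
  suff : measurable_fun setT (fun x : T => tnth c ord0 - x : T) by exact.
  by apply: measurable_funB => //; exact: measurable_cst.
- by rewrite -[X in measurable X]setTI; exact: measurable_tuple_reflect.
Qed.

Lemma measurable_tuple_box n (a b : 'I_n -> R) :
  measurable [set t : n.-tuple T | forall i, a i < tnth t i < b i].
Proof.
rewrite (_ : [set _ | _] =
  \big[setI/setT]_(i < n) ((fun t : n.-tuple T => tnth t i) @^-1` `]a i, b i[)).
  apply: bigsetI_measurable => i _; rewrite -[X in measurable X]setTI.
  exact: measurable_tnth.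
rewrite -bigcap_seq.
apply/seteqP; split => t /= h i; first by move=> _; rewrite /= in_itv/= h.
by have := h i; rewrite /= in_itv/=; apply; rewrite mem_index_enum.
Qed.

Lemma lebesgue_tuple_box n (a b : 'I_n -> R) : (forall i, a i <= b i) ->
  lebesgue_tuple R n [set t | forall i, a i < tnth t i < b i] =
  (\prod_(i < n) (b i - a i))%:E.
Proof.
elim: n a b => [|n IH] a b ab.
  by rewrite big_ord0 /= diracE mem_set// => -[].
rewrite /= /cons_measure /pushforward big_ord_recl EFinM -IH => [|i]; last exact: ab.
have -> : @consT R n @^-1` [set t | forall i, a i < tnth t i < b i] =
  `]a ord0, b ord0[%classic `*`
   [set t | forall i, a (lift ord0 i) < tnth t i < b (lift ord0 i)].
  apply/seteqP; split => -[x t] /=.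
    move=> h; split; first by have := h ord0; rewrite tnth0/= in_itv.
    by move=> i; have := h (lift ord0 i); rewrite tnthS.
  move=> [] h1 h2 i; case: (unliftP ord0 i) => [j ->|->].
    by rewrite tnthS.
  by rewrite tnth0; move: h1; rewrite in_itv.
rewrite product_measure1E//; last exact: measurable_tuple_box.
congr (_ * _)%E; etransitivity; first exact: lebesgue_measure_itv.
rewrite /= lte_fin.
by case: ltP => // ba; rewrite (_ : b _ = a ord0) ?subrr//; apply/eqP; rewrite eq_le ba ab.
Qed.

End lebesgue_tuple.

(** * The Euclidean norm and Lebesgue measure on row vectors *)

Section enorm_theory.
Context {R : realType} {d : nat}.
Implicit Types x y z : 'rV[R]_d.

Lemma enorm_ge0 x : 0 <= enorm x.
Proof. exact: sqrtr_ge0. Qed.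

Lemma sqr_enorm x : enorm x ^+ 2 = \sum_(i < d) x ord0 i ^+ 2.
Proof. by rewrite sqr_sqrtr// sumr_ge0// => i _; exact: sqr_ge0. Qed.

Lemma enormN x : enorm (- x) = enorm x.
Proof.
by congr Num.sqrt; apply: eq_bigr => i _; rewrite !mxE sqrrN.
Qed.

Lemma enormB x y : enorm (x - y) = enorm (y - x).
Proof. by rewrite -enormN opprB. Qed.

Lemma enorm_parallelogram x y :
  enorm (x + y) ^+ 2 + enorm (x - y) ^+ 2 = 2 * enorm x ^+ 2 + 2 * enorm y ^+ 2.
Proof.
rewrite !sqr_enorm !mulr_sumr -!big_split/=; apply: eq_bigr => i _.
by rewrite !mxE; ring.
Qed.

Lemma ler_sqr_enormD x y :
  enorm (x + y) ^+ 2 <= 2 * enorm x ^+ 2 + 2 * enorm y ^+ 2.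
Proof. by rewrite -enorm_parallelogram lerDl sqr_ge0. Qed.

(** A triangle inequality up to a factor, read off from the parallelogram law; the factor 2 is
    absorbed in constants wherever it is used. *)
Lemma ler_enormD2 x y : enorm (x + y) <= 2 * (enorm x + enorm y).
Proof.
have := ler_sqr_enormD x y.
have := enorm_ge0 x; have := enorm_ge0 y; have := enorm_ge0 (x + y).
by move: (enorm x) (enorm y) (enorm (x + y)) => a b c; nra.
Qed.

Lemma ler_coord_enorm x i : `|x ord0 i| <= enorm x.
Proof.
rewrite -(@ler_pXn2r _ 2)// ?nnegrE ?enorm_ge0// real_normK ?num_real// sqr_enorm.
rewrite (bigD1 i)//= lerDl sumr_ge0// => j _; exact: sqr_ge0.
Qed.

Lemma enorm_continuous : continuous (enorm : 'rV[R]_d -> R).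
Proof.
move=> x; apply: (@continuous_comp _ _ _ (fun x => \sum_(i < d) x ord0 i ^+ 2) Num.sqrt).
  apply: (continuous_big (op := +%R) (P := xpredT)); first exact: add_continuous.
  move=> i _ y; apply: (@continuous_comp _ _ _ (fun z : 'rV[R]_d => z ord0 i) (fun t : R => t ^+ 2)).
    exact: coord_continuous.
  exact: exprn_continuous.
exact: sqrt_continuous.
Qed.

End enorm_theory.

Section lebesgue_rV_theory.
Context {R : realType} {d : nat}.
Local Notation T := (measurableTypeR R).
Local Notation rV := 'rV[R]_d.
Local Notation mu := (@lebesgue_rV R d).

Definition rV_of_tuple (t : d.-tuple T) : rV := \row_i tnth t i.
Definition tuple_of_rV (x : rV) : d.-tuple T := [tuple x ord0 i | i < d].

Lemma rV_of_tupleK : cancel rV_of_tuple tuple_of_rV.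
Proof. by move=> x; apply/eq_from_tnth => i; rewrite tnth_mktuple mxE. Qed.

Lemma measurable_rVP (A : set rV) : measurable A <->
  forall X, mu X = (mu (X `&` A) + mu (X `&` ~` A))%E.
Proof. by []. Qed.

Lemma measurable_rV (A : set rV) :
  measurable (rV_of_tuple @^-1` A) -> measurable A.
Proof.
move=> mA; have := @sub_caratheodory _ _ _ (lebesgue_tuple R d) (rV_of_tuple @^-1` A).
move=> /(_ (sub_gen_smallest mA)) h; apply/measurable_rVP => X.
exact: (h (rV_of_tuple @^-1` X)).
Qed.

Lemma lebesgue_rVE (A : set rV) : measurable (rV_of_tuple @^-1` A) ->
  mu A = lebesgue_tuple R d (rV_of_tuple @^-1` A).
Proof. by move=> mA; rewrite -[RHS](measurable_mu_extE _ mA). Qed.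

Lemma measurable_coord_rV i : measurable_fun setT (fun x : rV => x ord0 i).
Proof.
move=> _ Y mY; rewrite setTI; apply: measurable_rV.
rewrite (_ : _ @^-1` _ = (fun t : d.-tuple T => tnth t i) @^-1` Y).
  by rewrite -[X in measurable X]setTI; exact: measurable_tnth.
by apply/funext => t; rewrite /preimage/= mxE.
Qed.

(** Needed for Tonelli's theorem, when the kernel is integrated over both of its variables. *)
Lemma lebesgue_rV_sigma_finite : sigma_finite setT mu.
Proof.
have [F FT Foo] := sigma_finiteT (lebesgue_tuple R d).
exists (fun k => tuple_of_rV @^-1` F k).
  apply/seteqP; split => // x _.
  have [k _ Fk] : (\bigcup_i F i) (tuple_of_rV x) by rewrite -FT.
  by exists k.
move=> k; have [mF Fk] := Foo k.
have e : rV_of_tuple @^-1` (tuple_of_rV @^-1` F k) = F k.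
  by apply/funext => t; rewrite /preimage/= rV_of_tupleK.
split; first by apply: measurable_rV; rewrite e.
by rewrite lebesgue_rVE e.
Qed.

HB.instance Definition _ := @Measure_isSigmaFinite.Build _ _ _ mu
  lebesgue_rV_sigma_finite.

(** Reflecting a countable measurable cover of [A] gives a cover of the preimage with the same total
    mass. The set [A] is arbitrary because Caratheodory's criterion tests against arbitrary sets;
    measurability of the reflection is deduced from this invariance. *)
Lemma lebesgue_rV_reflect_le (c : rV) (A : set rV) :
  (mu ((fun y => (c - y)%R) @^-1` A) <= mu A)%E.
Proof.
apply: ereal_inf_le_tmp => _ [F [mF AF] <-].
exists (fun k => tuple_reflect (tuple_of_rV c) @^-1` F k).
  split.
    move=> k; rewrite -[X in measurable X]setTI.
    by apply: measurable_tuple_reflect => //; exact: mF.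
  move=> t /= At.
  have [|k _ Fk] := AF (tuple_reflect (tuple_of_rV c) t) _; last by exists k.
  rewrite /=; move: At; congr A.
  by apply/rowP => i; rewrite !mxE !tnth_mktuple.
apply: eq_eseriesr => k _.
rewrite lebesgue_tuple_reflect//; exact: mF.
Qed.

Lemma lebesgue_rV_reflect (c : rV) (A : set rV) :
  mu ((fun y => c - y) @^-1` A) = mu A.
Proof.
apply/eqP; rewrite eq_le lebesgue_rV_reflect_le/=.
rewrite -[leLHS](_ : mu ((fun y => c - y) @^-1` ((fun y => c - y) @^-1` A)) = _).
  exact: lebesgue_rV_reflect_le.
congr (mu _); apply/funext => y; rewrite /preimage/=; congr A.
by rewrite subKr.
Qed.

Lemma measurable_reflect_rV (c : rV) : measurable_fun setT (fun y : rV => c - y).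
Proof.
move=> _ A /measurable_rVP mA; rewrite setTI; apply/measurable_rVP => X.
rewrite -(lebesgue_rV_reflect c X).
rewrite -(lebesgue_rV_reflect c (X `&` _)) -(lebesgue_rV_reflect c (X `&` ~` _)).
rewrite (mA ((fun y => c - y) @^-1` X)).
by congr (mu _ + mu _)%E; apply/funext => y; rewrite /preimage/= /setI/= ?/setC/= subKr.
Qed.

Lemma ge0_integral_reflect (c : rV) (h : rV -> \bar R) :
  measurable_fun setT h -> (forall y, 0 <= h y)%E ->
  (\int[mu]_y h (c - y)%R = \int[mu]_y h y)%E.
Proof.
move=> mh h0; pose phi (y : rV) : rV := c - y.
have mphi : measurable_fun setT phi := measurable_reflect_rV c.
transitivity (\int[pushforward mu phi]_y h y)%E.
  by rewrite ge0_integral_pushforward.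
by apply: eq_measure_integral => //= A mA _; exact: lebesgue_rV_reflect.
Qed.

Lemma measurable_enorm d' (S : measurableType d') (f : S -> rV) :
  (forall i, measurable_fun setT (fun s => f s ord0 i)) ->
  measurable_fun setT (fun s => enorm (f s)).
Proof.
move=> mf; apply: (measurableT_comp (f := @Num.sqrt R)).
  by apply: continuous_measurable_fun; exact: sqrt_continuous.
apply: measurable_sum => i; exact: measurable_funX.
Qed.

Lemma lebesgue_rV_box (a b : 'I_d -> R) : (forall i, a i <= b i) ->
  mu [set x | forall i, a i < x ord0 i < b i] = (\prod_(i < d) (b i - a i))%:E.
Proof.
move=> ab.
have e : rV_of_tuple @^-1` [set x | forall i, a i < x ord0 i < b i] =
    [set t | forall i, a i < tnth t i < b i].
  by apply/seteqP; split => t /= h i; have := h i; rewrite mxE.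
by rewrite lebesgue_rVE e ?lebesgue_tuple_box//; exact: measurable_tuple_box.
Qed.

Lemma measurable_box_rV (a b : 'I_d -> R) :
  measurable [set x : rV | forall i, a i < x ord0 i < b i].
Proof.
apply: measurable_rV.
rewrite (_ : _ @^-1` _ = [set t | forall i, a i < tnth t i < b i]).
  exact: measurable_tuple_box.
by apply/seteqP; split => t /= h i; have := h i; rewrite mxE.
Qed.

Lemma measurable_eball (x : rV) r : measurable (eball x r).
Proof.
have : measurable_fun setT (fun y : rV => enorm (y - x)).
  apply: measurable_enorm => i.
  under eq_fun do rewrite !mxE.
  apply: measurable_funB; first exact: measurable_coord_rV.
  exact: measurable_cst.
move=> /(_ measurableT `]-oo, r[%classic (measurable_itv _)).
by rewrite setTI; congr measurable.
Qed.

Lemma lebesgue_rV_eball_le (x : rV) r : 0 < r -> (mu (eball x r) <= ((2 * r) ^+ d)%:E)%E.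
Proof.
move=> r0.
rewrite (_ : (2 * r) ^+ d = \prod_(i < d) ((x ord0 i + r) - (x ord0 i - r))); last first.
  rewrite (eq_bigr (fun=> 2 * r)); first by rewrite prodr_const card_ord.
  by move=> i _; ring.
rewrite -lebesgue_rV_box; last by move=> i; lra.
apply: le_measure; rewrite ?inE; [exact: measurable_eball|exact: measurable_box_rV|].
move=> y; rewrite /eball/= => yx i.
have := le_lt_trans (ler_coord_enorm (y - x) i) yx.
by rewrite !mxE ltr_norml => /andP[? ?]; apply/andP; split; lra.
Qed.

End lebesgue_rV_theory.

(** * Integrals of powers by dyadic decomposition *)

Section dyadic.
Context {R : realType}.

Lemma dyadic_exponent (t : R) : 1 <= t -> exists k, 2 ^+ k <= t < 2 ^+ k.+1.
Proof.
move=> t1.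
have ex : exists n, t < 2 ^+ n.
  exists (Num.bound t); rewrite (lt_le_trans (archi_boundP _))//; first lra.
  by rewrite -natrX ler_nat ltnW// ltn_expl.
case: (ex_minnP ex) => -[|m] tm min.
  by move: tm; rewrite expr0 ltNge t1.
exists m; rewrite tm andbT leNgt; apply/negP => /min.
by rewrite ltnn.
Qed.

Context {dd : measure_display} {T : measurableType dd}.
Variables (mu : {measure set T -> \bar R}) (rho : T -> R) (n : nat).
Hypothesis mrho : measurable_fun setT rho.
Hypothesis mu_rho : forall r : R, 0 < r ->
  (mu [set x | rho x < r]%R <= ((2 * r) ^+ n)%:E)%E.

Let measurable_rho_lt (r : R) : measurable [set x | rho x < r].
Proof.
have := mrho measurableT (measurable_itv `]-oo, r[).
by rewrite setTI; congr measurable.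
Qed.

(** Pointwise, [f] is at most the sum over [k] of [b k] times the indicator of [rho < l k]; the
    volume bound on sublevel sets then turns the integral into a geometric series of ratio [q]. The
    function [rho] is abstract so as to cover both the distance to a point of R^d and the absolute
    value on the line, the latter for the Gamma integral. *)
Lemma dyadic_integral_le (f : T -> R) (l b : nat -> R) (M q : R) :
  measurable_fun setT f -> (forall x, 0 <= f x) ->
  (forall k, 0 < l k) -> (forall k, 0 <= b k) ->
  (forall x, f x != 0 -> exists k, rho x < l k /\ f x <= b k) ->
  0 <= M -> 0 < q < 1 -> (forall k, b k * (2 * l k) ^+ n <= M * q ^+ k) ->
  (\int[mu]_x (f x)%:E <= (M / (1 - q))%:E)%E.
Proof.
move=> mf f0 l0 b0 fb M0 /andP[q0 q1] bM.
pose g k (x : T) : \bar R := (b k * \1_[set x | rho x < l k] x)%:E.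
have g0 k x : (0 <= g k x)%E by rewrite lee_fin mulr_ge0.
have mg k : measurable_fun setT (g k).
  apply/measurable_EFinP; apply: measurable_funM; first exact: measurable_cst.
  exact: measurable_indic.
have fg x : ((f x)%:E <= \sum_(0 <= k <oo) g k x)%E.
  have [->|/fb[k [xl fxb]]] := eqVneq (f x) 0; first exact: nneseries_ge0.
  apply: (@le_trans _ _ (\sum_(0 <= i < k.+1) g i x)%E); last exact: nneseries_lim_ge.
  rewrite big_nat_recr//=; apply: (@le_trans _ _ (g k x)).
    by rewrite /g indicE mem_set// mulr1 lee_fin.
  by rewrite leeDr// sume_ge0.
apply: (@le_trans _ _ (\int[mu]_x \sum_(0 <= k <oo) g k x)%E).
  apply: ge0_le_integral => //.
  - by move=> x _; rewrite lee_fin.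
  - exact/measurable_EFinP.
  - exact: (ge0_emeasurable_sum (P := xpredT)).
rewrite integral_nneseries//.
have gk k : (\int[mu]_x g k x <= (M * q ^+ k)%:E)%E.
  rewrite /g; under eq_integral do rewrite EFinM.
  rewrite ge0_integralZl//; [|exact/measurable_EFinP/measurable_indic|by rewrite lee_fin].
  rewrite integral_indic// setIT.
  apply: (@le_trans _ _ ((b k)%:E * ((2 * l k) ^+ n)%:E)%E).
    by apply: lee_wpmul2l; [rewrite lee_fin|exact: mu_rho].
  by rewrite -EFinM lee_fin.
apply: lime_le; first by apply: is_cvg_nneseries => k _ _; exact: integral_ge0.
apply: nearW => N; apply: (@le_trans _ _ (\sum_(0 <= k < N) (M * q ^+ k)%:E)%E).
  exact: lee_sum.
rewrite sumEFin lee_fin.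
apply: le_trans (@geometric_le_lim _ N M q M0 q0 _); last by rewrite gtr0_norm.
by rewrite /series/=.
Qed.

Let two_powRN_lt1 (s : R) : 0 < s -> 0 < (2 : R) `^ (- s) < 1.
Proof.
move=> s0; rewrite powR_gt0//= powRN invf_lt1 ?powR_gt0//.
by have := gt0_ltr_powR s0 (x := 1) (y := 2); rewrite powR1 !nnegrE ltr1n; exact.
Qed.

Let powR_exprn (s : R) k : 0 < s -> (2 ^+ k : R) `^ (- s) = (2 `^ (- s)) ^+ k.
Proof. by move=> s0; rewrite -[RHS]powR_mulrn ?powR_ge0// powRAC powR_mulrn. Qed.

Lemma integral_tail_le (s r : R) : 0 < s -> 0 < r ->
  (\int[mu]_x (if (r <= rho x)%R then rho x `^ (- (n%:R + s)) else 0%R)%:E <=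
   (4 ^+ n / (1 - 2 `^ (- s)) * r `^ (- s))%:E)%E.
Proof.
move=> s0 r0.
have pr k : 0 < 2 ^+ k * r by rewrite mulr_gt0// exprn_gt0.
rewrite [leRHS](_ : _ = (4 ^+ n * r `^ (- s) / (1 - 2 `^ (- s)))%:E); last by congr EFin; ring.
(* Shells between [2 ^+ k * r] and [2 ^+ k.+1 * r]: the power is largest at the inner radius and the
   volume is taken at the outer one. One factor 2 from the shell and one from the volume bound give
   [4 ^+ n]. *)
apply: (@dyadic_integral_le _ (fun k => 2 ^+ k.+1 * r)
  (fun k => (2 ^+ k * r) `^ (- (n%:R + s)))) => //.
- apply: measurable_fun_ifT => //.
  + exact: measurable_fun_ler.
  + exact: (measurableT_comp (measurable_powR _)).
- by move=> x; case: ifP => // _; rewrite powR_ge0.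
- by move=> k; rewrite powR_ge0.
- move=> x; case: ifP => [rx _|]; last by rewrite eqxx.
  have /dyadic_exponent[k /andP[k1 k2]] : 1 <= rho x / r by rewrite ler_pdivlMr ?mul1r.
  exists k; split; first by rewrite -ltr_pdivrMr.
  rewrite !powRN lef_pV2 ?posrE ?powR_gt0 ?(lt_le_trans r0 rx)//.
  apply: ge0_ler_powR; rewrite ?nnegrE ?(ltW (pr k)) ?(le_trans (ltW r0) rx)//.
    by rewrite addr_ge0// ltW.
  by rewrite -ler_pdivlMr.
- by rewrite mulr_ge0// powR_ge0.
- exact: two_powRN_lt1.
- move=> k; rewrite opprD (@powRD _ (2 ^+ k * r)); last by apply/implyP => _; rewrite gt_eqF.
  rewrite [_ `^ (- n%:R)]powRN.
  rewrite powR_mulrn ?(ltW (pr k))//.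
  rewrite (_ : 2 * (2 ^+ k.+1 * r) = 4 * (2 ^+ k * r)); last by rewrite exprS; ring.
  rewrite [(4 * _) ^+ n]exprMn [(_ * r) `^ _]powRM ?exprn_ge0// ?(ltW r0)//.
  rewrite powR_exprn// le_eqVlt; apply/orP; left; apply/eqP.
  by field; rewrite expf_neq0// gt_eqF.
Qed.

Lemma integral_near_le (s r : R) : 0 < s -> 0 < r ->
  (\int[mu]_x (if ((0 < rho x) && (rho x <= r))%R then rho x `^ (s - n%:R) else 0%R)%:E <=
   (8 ^+ n / (1 - 2 `^ (- s)) * r `^ s)%:E)%E.
Proof.
move=> s0 r0.
have pr k : 0 < r / 2 ^+ k by rewrite divr_gt0// exprn_gt0.
rewrite [leRHS](_ : _ = (8 ^+ n * r `^ s / (1 - 2 `^ (- s)))%:E); last by congr EFin; ring.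
(* The sign of [s - n] is unknown, so the two factors of the power are bounded separately, [rho ^ s]
   at the outer radius of the shell and [rho ^ - n] at the inner one. The extra factor 2 in the
   level makes the inequality [rho x < l k] strict. *)
apply: (@dyadic_integral_le _ (fun k => 2 * (r / 2 ^+ k))
  (fun k => (r / 2 ^+ k) `^ s * (r / 2 ^+ k.+1) ^- n)) => //.
- apply: measurable_fun_ifT => //.
  + by apply: measurable_and; [exact: measurable_fun_ltr|exact: measurable_fun_ler].
  + exact: (measurableT_comp (measurable_powR _)).
- by move=> x; case: ifP => // _; rewrite powR_ge0.
- by move=> k; rewrite mulr_gt0.
- by move=> k; rewrite mulr_ge0 ?powR_ge0// invr_ge0 exprn_ge0// ltW.
- move=> x; case: ifP => [/andP[x0 xr] _|]; last by rewrite eqxx.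
  have /dyadic_exponent[k /andP[k1 k2]] : 1 <= r / rho x by rewrite ler_pdivlMr ?mul1r.
  have xk : rho x <= r / 2 ^+ k.
    by rewrite ler_pdivlMr ?exprn_gt0// mulrC -ler_pdivlMr.
  exists k; split; first by apply: (le_lt_trans xk); rewrite ltr_pMl// ltr1n.
  rewrite (@powRD _ (rho x)); last by apply/implyP => _; rewrite gt_eqF.
  rewrite powRN powR_mulrn ?(ltW x0)//.
  apply: ler_pM; rewrite ?powR_ge0 ?invr_ge0 ?exprn_ge0 ?(ltW x0)//.
    by apply: ge0_ler_powR; rewrite ?nnegrE ?(ltW x0) ?(ltW (pr k)) ?(ltW s0).
  rewrite lef_pV2 ?posrE ?exprn_gt0// lerXn2r ?nnegrE ?(ltW x0) ?(ltW (pr _))//.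
  by rewrite ler_pdivrMr ?exprn_gt0// mulrC -ler_pdivrMr// ltW.
- by rewrite mulr_ge0// powR_ge0.
- exact: two_powRN_lt1.
- move=> k; rewrite powRM ?(ltW r0) ?invr_ge0 ?exprn_ge0//.
  rewrite -[(2 ^+ k)^-1]powR_inv1 ?exprn_ge0// -powRrM mulN1r powR_exprn//.
  rewrite powR_inv1 ?exprn_ge0//.
  rewrite (_ : 2 * (2 * (r / 2 ^+ k)) = 8 * (r / 2 ^+ k.+1)); last first.
    by rewrite exprS; field; rewrite expf_neq0.
  rewrite [(8 * _) ^+ n]exprMn le_eqVlt; apply/orP; left; apply/eqP.
  by field; rewrite expf_neq0// gt_eqF.
Qed.

End dyadic.

(** * Positivity of the normalizing constant *)

Section Gamma_gt0.
Context {R : realType}.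
Local Notation mu := (@lebesgue_measure R).

(** For an integer [m] above [|s|], the exponential of [t] is the [m]-th power of that of [t / m],
    hence at least [(t / m) ^+ m]; this gives the constant [m ^ m]. *)
Lemma powR_le_expR (s : R) : exists2 C : R, 0 <= C &
  forall t, 1 <= t -> t `^ s * expR (- t) <= C.
Proof.
pose m := (Num.bound `|s|).+1; have m0 : 0 < m%:R :> R by rewrite ltr0n.
exists (m%:R ^+ m); first by rewrite exprn_ge0.
move=> t t1; have t0 : 0 < t by rewrite (lt_le_trans _ t1).
have sm : t `^ s <= t ^+ m.
  rewrite -powR_mulrn ?(ltW t0)// ler_powR//.
  rewrite (le_trans (ler_norm s))// ltW// (lt_le_trans (archi_boundP _))//.
  by rewrite ler_nat.
rewrite expRN ler_pdivrMr ?expR_gt0// (le_trans sm)//.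
have -> : expR t = expR (t / m%:R) ^+ m by rewrite -expRM_natr divfK// gt_eqF.
rewrite -exprMn lerXn2r ?nnegrE ?(ltW t0) ?mulr_ge0 ?expR_ge0//.
rewrite mulrC -ler_pdivrMr//; apply: le_trans (expR_ge1Dx _); rewrite lerDr//.
Qed.

Lemma lebesgue_measure_norm_lt (r : R) : 0 < r ->
  (mu [set x | (`|x| < r)%R] <= ((2 * r) ^+ 1)%:E)%E.
Proof.
move=> r0; rewrite (_ : [set x | _] = `]- r, r[%classic).
  by rewrite lebesgue_measure_itv/= lte_fin gtrN// -EFinB lee_fin expr1; lra.
by apply/seteqP; split => x /=; rewrite in_itv/= ltr_norml.
Qed.

Lemma Gamma_gt0 (z : R) : 0 < z -> 0 < Gamma z.
Proof.
move=> z0; pose f (t : R) := t `^ (z - 1) * expR (- t).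
have f0 t : 0 <= f t by rewrite mulr_ge0// ?powR_ge0 ?expR_ge0.
have mf : measurable_fun setT f.
  apply: measurable_funM; first exact: measurable_powR.
  by apply: measurableT_comp => //; exact: measurable_funN.
have mnorm : measurable_fun setT (fun t : R => `|t|) by exact: normr_measurable.
(* [fine] sends [+oo] to 0, so finiteness is to be proved along with positivity. For the latter, on
   [[1, 2]] one has [t ^ (z - 1) >= 1/2] because [t ^ z >= 1]. *)
rewrite /Gamma /Rintegral fine_gt0//; apply/andP; split.

- apply: (@lt_le_trans _ _ (\int[mu]_(t in [set` `[1%R : R, 2%R]]) (2^-1 * expR (- 2))%:E)%E).
    rewrite integral_cst//= lebesgue_measure_itv/= lte_fin ltr1n -EFinB -EFinM lte_fin.
    by rewrite !mulr_gt0 ?expR_gt0//; lra.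
  apply: (@le_trans _ _ (\int[mu]_(t in [set` `[1%R : R, 2%R]]) (f t)%:E)%E).
    apply: ge0_le_integral => //.
    + by apply/measurable_EFinP; exact: measurable_funTS.
    + move=> t; rewrite /= in_itv/= => /andP[t1 t2]; rewrite lee_fin.
      have t0 : 0 < t by lra.
      rewrite ler_pM ?expR_ge0// ?ler_expR; last by lra.
      rewrite powRB; last by apply/implyP => _; rewrite gt_eqF.
      rewrite powRr1 ?(ltW t0)// ler_pdivlMr//.
      have : 1 <= t `^ z by rewrite -[leLHS](powRr0 t) ler_powR// ltW.
      by lra.
  apply: ge0_subset_integral => //.
  + by apply/measurable_EFinP; exact: measurable_funTS.
  + by move=> x _; rewrite lee_fin.
  + by move=> t; rewrite /= !in_itv/= andbT => /andP[+ _]; apply: lt_le_trans.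
(* Domination by [t ^ (z - 1)] up to 1, and beyond 1 by [C * t ^ (- 2)], from
   [t ^ (z - 1) = t ^ (z + 1) * t ^ (- 2)]. Both majorants are written in [|t|], to fall under the
   dyadic bounds with [n = 1]. *)
- have [C C0 HC] := powR_le_expR (z + 1).
  pose g1 (t : R) := if ((0 < `|t|) && (`|t| <= 1)) then `|t| `^ (z - 1%:R) else 0.
  pose g2 (t : R) := if (1 <= `|t|) then `|t| `^ (- (1%:R + 1)) else 0.
  have mg1 : measurable_fun setT g1.
    apply: measurable_fun_ifT.
    + by apply: measurable_and; [exact: measurable_fun_ltr|exact: measurable_fun_ler].
    + exact: (measurableT_comp (measurable_powR _)).
    + exact: measurable_cst.
  have mg2 : measurable_fun setT g2.
    apply: measurable_fun_ifT.
    + exact: measurable_fun_ler.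
    + exact: (measurableT_comp (measurable_powR _)).
    + exact: measurable_cst.
  have g10 t : 0 <= g1 t by rewrite /g1; case: ifP => // _; exact: powR_ge0.
  have g20 t : 0 <= g2 t by rewrite /g2; case: ifP => // _; exact: powR_ge0.
  apply: (@le_lt_trans _ _ (\int[mu]_t ((g1 t)%:E + C%:E * (g2 t)%:E))%E).
    rewrite integral_mkcond; apply: ge0_le_integral => //.
    + by move=> x _; rewrite /patch; case: ifP => // _; rewrite lee_fin; exact: f0.
    + by apply/(measurable_restrictT _ _).1 => //; apply/measurable_EFinP; exact: measurable_funTS.
    + apply: emeasurable_funD; first exact/measurable_EFinP.
      by apply/measurable_EFinP; apply: measurable_funM => //; exact: measurable_cst.
    + move=> t _; rewrite /patch; case: ifPn => [|_]; last first.
        by rewrite adde_ge0// ?mule_ge0 ?lee_fin.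
      rewrite inE/= in_itv/= andbT => t0.
      rewrite -EFinM -EFinD lee_fin.
      have [t1|t1] := leP t 1.
        rewrite (@le_trans _ _ (g1 t))// ?lerDl ?mulr_ge0//.
        rewrite /g1 gtr0_norm// t0 t1/= /f ler_piMr ?powR_ge0//.
        by rewrite -expR0 ler_expR; lra.
      rewrite (@le_trans _ _ (C * g2 t))// ?lerDr ?g10//.
      rewrite /g2 gtr0_norm// (ltW t1) /f.
      have -> : z - 1 = (z + 1) - (1%:R + 1) by rewrite mulr1n; ring.
      rewrite powRD; last by apply/implyP => _; rewrite gt_eqF.
      by rewrite mulrAC ler_wpM2r ?powR_ge0 ?HC// ltW.
  have l1 := @integral_near_le R _ (measurableTypeR R) mu (fun t => `|t|) 1 mnorm lebesgue_measure_norm_lt _ _ z0 ltr01.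
  have l2 := @integral_tail_le R _ (measurableTypeR R) mu (fun t => `|t|) 1 mnorm lebesgue_measure_norm_lt _ _ ltr01 ltr01.
  rewrite ge0_integralD//; last 2 first.
    + by move=> x _; rewrite mule_ge0 ?lee_fin.
    + by apply/measurable_EFinP; apply: measurable_funM => //; exact: measurable_cst.
  + rewrite ge0_integralZl//; last 2 first.
      exact/measurable_EFinP.
      by move=> x _; rewrite lee_fin.
    rewrite lte_add_pinfty//; first exact: (le_lt_trans l1 (ltry _)).
    by rewrite lte_mul_pinfty// ?lee_fin//; exact: (le_lt_trans l2 (ltry _)).
  + by move=> x _; rewrite lee_fin.
  + exact/measurable_EFinP.
Qed.

Lemma frac_laplacian_cst_gt0 (d : nat) (a : R) : 0 < a < 2 ->
  0 < @frac_laplacian_cst R d a.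
Proof.
move=> /andP[a0 a2]; rewrite /frac_laplacian_cst.
rewrite divr_gt0// !mulr_gt0// ?powR_gt0 ?pi_gt0// Gamma_gt0//; last by lra.
by rewrite divr_gt0// ltr_wpDl.
Qed.

End Gamma_gt0.

(** * Truncated kernels *)

Section ge0_real_integral.
Context {dd : measure_display} {T : measurableType dd} {R : realType}.
Variable mu : {measure set T -> \bar R}.
Implicit Types f g : T -> R.

Lemma integralTD f g : measurable_fun setT f -> measurable_fun setT g ->
  (forall x, 0 <= f x) -> (forall x, 0 <= g x) ->
  (\int[mu]_x (f x + g x)%:E = \int[mu]_x (f x)%:E + \int[mu]_x (g x)%:E)%E.
Proof.
move=> mf mg f0 g0; under eq_integral do rewrite EFinD.
apply: ge0_integralD.
- exact: measurableT.
- by move=> x _; rewrite lee_fin.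
- exact/measurable_EFinP.
- by move=> x _; rewrite lee_fin.
- exact/measurable_EFinP.
Qed.

Lemma integralTZl (c : R) f : measurable_fun setT f ->
  (forall x, 0 <= f x) -> 0 <= c ->
  (\int[mu]_x (c * f x)%:E = c%:E * \int[mu]_x (f x)%:E)%E.
Proof.
move=> mf f0 c0; under eq_integral do rewrite EFinM.
apply: ge0_integralZl.
- exact: measurableT.
- exact/measurable_EFinP.
- by move=> x _; rewrite lee_fin.
- by rewrite lee_fin.
Qed.

Lemma le_integralT f g : measurable_fun setT f -> measurable_fun setT g ->
  (forall x, 0 <= f x <= g x) ->
  (\int[mu]_x (f x)%:E <= \int[mu]_x (g x)%:E)%E.
Proof.
move=> mf mg fg; apply: ge0_le_integral.
- exact: measurableT.
- by move=> x _; rewrite lee_fin; case/andP: (fg x).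
- exact/measurable_EFinP.
- exact/measurable_EFinP.
- by move=> x _; rewrite lee_fin; case/andP: (fg x).
Qed.

Lemma integralT_ge0 f : (forall x, 0 <= f x) -> (0 <= \int[mu]_x (f x)%:E)%E.
Proof. by move=> f0; apply: integral_ge0 => x _; rewrite lee_fin. Qed.

End ge0_real_integral.

Section jump_kernel.
Context {R : realType} {d : nat}.
Local Notation rV := 'rV[R]_d.
Local Notation mu := (@lebesgue_rV R d).
Implicit Types x y z : rV.

Lemma measurable_enormB x : measurable_fun setT (fun y : rV => enorm (y - x)).
Proof.
apply: measurable_enorm => i.
under eq_fun do rewrite !mxE.
apply: measurable_funB; first exact: measurable_coord_rV.
exact: measurable_cst.
Qed.

(** The kernel of the fractional Laplacian without its constant, cut off at distance [e]. Being zero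
    near the diagonal it is integrable for [0 < e], and it depends on [y - x] only through its norm,
    hence the symmetry and the invariance under reflection about [x]. *)
Definition jump_kernel (a e : R) x y : R :=
  if e < enorm (y - x) then enorm (y - x) `^ (- (d%:R + a)) else 0.

Lemma jump_kernel_ge0 a e x y : 0 <= jump_kernel a e x y.
Proof. by rewrite /jump_kernel; case: ifP => // _; exact: powR_ge0. Qed.

Lemma jump_kernelC a e x y : jump_kernel a e x y = jump_kernel a e y x.
Proof. by rewrite /jump_kernel enormB. Qed.

Lemma jump_kernel_reflect a e x y :
  jump_kernel a e x (x + x - y) = jump_kernel a e x y.
Proof. by rewrite /jump_kernel (_ : x + x - y - x = x - y) 1?enormB// addrAC addrK. Qed.

Lemma measurable_jump_kernel2 a e :
  measurable_fun setT (fun p : rV * rV => jump_kernel a e p.1 p.2).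
Proof.
have m : measurable_fun setT (fun p : rV * rV => enorm (p.2 - p.1)).
  apply: measurable_enorm => i.
  under eq_fun do rewrite !mxE.
  apply: measurable_funB.
    exact: (measurableT_comp (measurable_coord_rV i) measurable_snd).
  exact: (measurableT_comp (measurable_coord_rV i) measurable_fst).
rewrite /jump_kernel; apply: measurable_fun_ifT.
- by apply: measurable_fun_ltr => //; exact: measurable_cst.
- exact: (measurableT_comp (measurable_powR _)).
- exact: measurable_cst.
Qed.

Lemma measurable_jump_kernel a e x : measurable_fun setT (jump_kernel a e x).
Proof.
rewrite /jump_kernel; apply: measurable_fun_ifT.
- by apply: measurable_fun_ltr; [exact: measurable_cst|exact: measurable_enormB].
- exact: (measurableT_comp (measurable_powR _) (measurable_enormB x)).
- exact: measurable_cst.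
Qed.

Lemma integral_kernel_reflect x (h k : rV -> R) :
  measurable_fun setT h -> measurable_fun setT k ->
  (forall y, 0 <= h y) -> (forall y, 0 <= k y) ->
  (forall y, k (x + x - y) = k y) ->
  (\int[mu]_y (h (x + x - y)%R * k y)%:E = \int[mu]_y (h y * k y)%:E)%E.
Proof.
move=> mh mk h0 k0 kx.
rewrite -[RHS](ge0_integral_reflect (x + x)); last 2 first.
- by apply/measurable_EFinP; exact: measurable_funM.
- by move=> y; rewrite lee_fin mulr_ge0.
by apply: eq_integral => y _; rewrite kx.
Qed.

Section second_difference.
Variables (x : rV) (h k M : rV -> R).
Hypotheses (mh : measurable_fun setT h) (mk : measurable_fun setT k)
  (mM : measurable_fun setT M).
Hypotheses (h0 : forall y, 0 <= h y) (k0 : forall y, 0 <= k y)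
  (M0 : forall y, 0 <= M y).
Hypothesis kx : forall y, k (x + x - y) = k y.

Let mhx : measurable_fun setT (fun y => h (x + x - y)).
Proof. exact: (measurableT_comp mh (measurable_reflect_rV (x + x))). Qed.

Let mM2 : measurable_fun setT (fun y => 2 * M y).
Proof. by apply: measurable_funM; [exact: measurable_cst|exact: mM]. Qed.

Let intM2k : (\int[mu]_y ((2 * M y) * k y)%:E = 2%:E * \int[mu]_y (M y * k y)%:E)%E.
Proof.
rewrite -integralTZl.
- by apply: eq_integral => y _; rewrite mulrA.
- exact: measurable_funM.
- by move=> y; rewrite mulr_ge0.
- by [].
Qed.

Let inthk2 : (\int[mu]_y ((h y + h (x + x - y)%R) * k y)%:E = 2%:E * \int[mu]_y (h y * k y)%:E)%E.
Proof.
transitivity (\int[mu]_y (h y * k y)%:E + \int[mu]_y (h (x + x - y)%R * k y)%:E)%E.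
  rewrite -integralTD.
  - by apply: eq_integral => y _; rewrite mulrDl.
  - exact: measurable_funM.
  - exact: measurable_funM.
  - by move=> y; rewrite mulr_ge0.
  - by move=> y; rewrite mulr_ge0.
by rewrite integral_kernel_reflect// -mule2n -mule_natl.
Qed.

(** As [k] is symmetric about [x], twice the integral of [h * k] is the integral of
    [h y + h (x + x - y)] against [k], so a one-sided bound on second differences suffices. Sums on
    both sides in place of differences allow infinite integrals. *)
Lemma second_difference_le :
  (forall y, k y != 0 -> 2 * h x <= h y + h (x + x - y) + 2 * M y) ->
  ((h x)%:E * \int[mu]_y (k y)%:E <=
   \int[mu]_y (h y * k y)%:E + \int[mu]_y (M y * k y)%:E)%E.
Proof.
move=> hM.
rewrite -(@lee_pmul2l _ 2%:E)// muleA -EFinM -integralTZl ?mulr_ge0//.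
rewrite [leRHS]ge0_muleDr; last 2 first.
- by apply: integralT_ge0 => y; rewrite mulr_ge0.
- by apply: integralT_ge0 => y; rewrite mulr_ge0.
rewrite -inthk2 -intM2k -integralTD.
- apply: le_integralT.
  + by apply: measurable_funM; [exact: measurable_cst|exact: mk].
  + apply: measurable_funD; (apply: measurable_funM; last exact: mk).
      exact: measurable_funD.
    exact: mM2.
  + move=> y; rewrite !mulr_ge0//=.
    have [->|/hM hy] := eqVneq (k y) 0; first by rewrite !mulr0 addr0.
    by rewrite -mulrDl ler_wpM2r.
- by apply: measurable_funM; [exact: measurable_funD|exact: mk].
- exact: measurable_funM.
- by move=> y; rewrite mulr_ge0// addr_ge0.
- by move=> y; rewrite !mulr_ge0.
Qed.

Lemma second_difference_ge :
  (forall y, k y != 0 -> h y + h (x + x - y) <= 2 * h x + 2 * M y) ->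
  (\int[mu]_y (h y * k y)%:E <=
   (h x)%:E * \int[mu]_y (k y)%:E + \int[mu]_y (M y * k y)%:E)%E.
Proof.
move=> hM.
rewrite -(@lee_pmul2l _ 2%:E)// [leRHS]ge0_muleDr; last 2 first.
- by rewrite mule_ge0 ?lee_fin// integralT_ge0.
- by apply: integralT_ge0 => y; rewrite mulr_ge0.
rewrite -inthk2 -intM2k muleA -EFinM -integralTZl ?mulr_ge0// -integralTD.
- apply: le_integralT.
  + by apply: measurable_funM; [exact: measurable_funD|exact: mk].
  + apply: measurable_funD; (apply: measurable_funM; last exact: mk).
      exact: measurable_cst.
    exact: mM2.
  + move=> y; rewrite mulr_ge0 ?addr_ge0//=.
    have [->|/hM hy] := eqVneq (k y) 0; first by rewrite !mulr0 addr0.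
    by rewrite -mulrDl ler_wpM2r.
- by apply: measurable_funM; [exact: measurable_cst|exact: mk].
- exact: measurable_funM.
- by move=> y; rewrite !mulr_ge0.
- by move=> y; rewrite !mulr_ge0.
Qed.

End second_difference.

Section kernel_bounds.
Variable a : R.
Hypothesis a02 : 0 < a < 2.

Let mu_eball x (r : R) : 0 < r ->
  (mu [set y | enorm (y - x) < r]%R <= ((2 * r) ^+ d)%:E)%E.
Proof. exact: lebesgue_rV_eball_le. Qed.

Let a0 : 0 < a. Proof. by case/andP: a02. Qed.

Let inv1B_gt0 (s : R) : 0 < s -> 0 < (1 - 2 `^ (- s) : R)^-1.
Proof.
move=> s0; rewrite invr_gt0 subr_gt0 powRN invf_lt1 ?powR_gt0//.
by have := gt0_ltr_powR s0 (x := 1) (y := 2); rewrite powR1 !nnegrE ltr1n; exact.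
Qed.

Let measurable_near x (s r : R) :
  measurable_fun setT (fun y => if enorm (y - x) <= r then enorm (y - x) `^ s else 0).
Proof.
apply: measurable_fun_ifT.
- by apply: measurable_fun_ler; [exact: measurable_enormB|exact: measurable_cst].
- exact: (measurableT_comp (measurable_powR _) (measurable_enormB x)).
- exact: measurable_cst.
Qed.

Lemma integral_jump_kernel_le : exists2 C : R, 0 < C & forall e x r, 0 < r ->
  (\int[mu]_y (if (r <= enorm (y - x))%R then jump_kernel a e x y else 0%R)%:E
    <= (C * r `^ (- a))%:E)%E.
Proof.
exists (4 ^+ d / (1 - 2 `^ (- a))).
  by rewrite mulr_gt0 ?exprn_gt0 ?inv1B_gt0.
move=> e x r r0.
apply: le_trans (integral_tail_le (measurable_enormB x) (@mu_eball x) a0 r0).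
have m1 : measurable_fun setT (fun y => r <= enorm (y - x)).
  by apply: measurable_fun_ler; [exact: measurable_cst|exact: measurable_enormB].
apply: le_integralT.
- by apply: measurable_fun_ifT; [exact: m1|exact: measurable_jump_kernel|exact: measurable_cst].
- apply: measurable_fun_ifT; [exact: m1| |exact: measurable_cst].
  exact: (measurableT_comp (measurable_powR _) (measurable_enormB x)).
- move=> y; case: ifP => ry; last by rewrite lexx.
  by rewrite jump_kernel_ge0/= /jump_kernel; case: ifP => // _; exact: powR_ge0.
Qed.

Lemma integral_near_kernel_le (s : R) : a < s ->
  exists2 C : R, 0 < C & forall e x r, 0 < e -> 0 < r ->
  (\int[mu]_y ((if (enorm (y - x) <= r)%R then enorm (y - x) `^ s else 0%R)
      * jump_kernel a e x y)%:E <= (C * r `^ (s - a))%:E)%E.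
Proof.
move=> sa; have sa0 : 0 < s - a by rewrite subr_gt0.
exists (8 ^+ d / (1 - 2 `^ (- (s - a)))).
  by rewrite mulr_gt0 ?exprn_gt0 ?inv1B_gt0.
move=> e x r e0 r0.
apply: le_trans (integral_near_le (measurable_enormB x) (@mu_eball x) sa0 r0).
apply: le_integralT.
- apply: measurable_funM; last exact: measurable_jump_kernel.
  exact: measurable_near.
- apply: measurable_fun_ifT; last exact: measurable_cst.
    apply: measurable_and.
      by apply: measurable_fun_ltr; [exact: measurable_cst|exact: measurable_enormB].
    by apply: measurable_fun_ler; [exact: measurable_enormB|exact: measurable_cst].
  exact: (measurableT_comp (measurable_powR _) (measurable_enormB x)).
- move=> y; apply/andP; split.
    apply: mulr_ge0; last exact: jump_kernel_ge0.
    by case: ifP => // _; exact: powR_ge0.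
  rewrite /jump_kernel; have [ey|_] := ltP e (enorm (y - x)); last first.
    by rewrite mulr0; case: ifP => // _; exact: powR_ge0.
  have y0 : 0 < enorm (y - x) := lt_trans e0 ey.
  rewrite y0 /=; case: ifP => _; last by rewrite mul0r.
  rewrite -powRD; last by apply/implyP => _; rewrite gt_eqF.
  by rewrite (_ : s + _ = s - a - d%:R)//; ring.
Qed.

Lemma jump_kernel_mass_le : exists2 C : R, 0 < C & forall e x, 0 < e ->
  (\int[mu]_y (jump_kernel a e x y)%:E <= (C * e `^ (- a))%:E)%E.
Proof.
have [C C0 HC] := integral_jump_kernel_le; exists C => // e x e0.
apply: le_trans (HC e x e e0).
rewrite le_eqVlt; apply/orP; left; apply/eqP; apply: eq_integral => y _.
case: ifP => // /negbT; rewrite -ltNge => ye; rewrite /jump_kernel ifN//.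
by rewrite -leNgt ltW.
Qed.

Lemma jump_kernel_integral_lty e x : 0 < e ->
  (\int[mu]_y (jump_kernel a e x y)%:E < +oo)%E.
Proof.
move=> e0; have [C C0 HC] := jump_kernel_mass_le.
exact: le_lt_trans (HC e x e0) (ltry _).
Qed.

(** The minimum is the modulus of the second differences of the cap of radius [r]. Cut at distance
    [r]: the quadratic part converges since [a < 2] and gives [r ^ (- 2) * r ^ (2 - a)], the tail
    gives [r ^ (- a)]. The constant does not depend on [e]. *)
Lemma integral_min_kernel_le : exists2 C : R, 0 < C & forall e x r, 0 < e -> 0 < r ->
  (\int[mu]_y (Num.min ((enorm (y - x) / r) ^+ 2) 1%R * jump_kernel a e x y)%:E
    <= (C * r `^ (- a))%:E)%E.
Proof.
have a2 : a < 2 by case/andP: a02.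
have [C1 C10 H1] := integral_near_kernel_le a2.
have [C2 C20 H2] := integral_jump_kernel_le.
exists (C1 + C2); first exact: addr_gt0.
move=> e x r e0 r0.
pose f1 y := (if enorm (y - x) <= r then enorm (y - x) `^ 2 else 0) * jump_kernel a e x y.
pose f2 y := if r <= enorm (y - x) then jump_kernel a e x y else 0.
have mf1 : measurable_fun setT f1.
  by apply: measurable_funM; [exact: measurable_near|exact: measurable_jump_kernel].
have mf2 : measurable_fun setT f2.
  apply: measurable_fun_ifT; [|exact: measurable_jump_kernel|exact: measurable_cst].
  by apply: measurable_fun_ler; [exact: measurable_cst|exact: measurable_enormB].
have f10 y : 0 <= f1 y.
  by rewrite mulr_ge0 ?jump_kernel_ge0//; case: ifP => // _; exact: powR_ge0.
have f20 y : 0 <= f2 y by rewrite /f2; case: ifP => // _; exact: jump_kernel_ge0.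
have mf1' : measurable_fun setT (fun y => r ^- 2 * f1 y).
  by apply: measurable_funM; [exact: measurable_cst|exact: mf1].
have r2 : 0 <= r ^- 2 by rewrite invr_ge0 sqr_ge0.
apply: (@le_trans _ _ (\int[mu]_y (r ^- 2 * f1 y + f2 y)%:E)%E).
  apply: le_integralT.
  - apply: measurable_funM; last exact: measurable_jump_kernel.
    apply: measurable_minr; last exact: measurable_cst.
    apply: measurable_funX; apply: measurable_funM; last exact: measurable_cst.
    exact: measurable_enormB.
  - by apply: measurable_funD; [exact: mf1'|exact: mf2].
  - move=> y; rewrite mulr_ge0 ?jump_kernel_ge0 ?le_min ?sqr_ge0//=.
    rewrite /f1 /f2; have k0 := jump_kernel_ge0 a e x y.
    have [yr|yr] := leP (enorm (y - x)) r; last first.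
      by rewrite (ltW yr) mul0r mulr0 add0r ler_piMl// ge_min lexx orbT.
    rewrite (@le_trans _ _ (r ^- 2 * (enorm (y - x) `^ 2 * jump_kernel a e x y)))//.
      rewrite mulrA ler_wpM2r// ge_min; apply/orP; left.
      by rewrite powR_mulrn ?enorm_ge0// expr_div_n mulrC.
    by rewrite lerDl; case: ifP.
rewrite integralTD//; last by move=> y; rewrite mulr_ge0.
rewrite integralTZl// mulrDl EFinD leeD//; last exact: H2.
rewrite (@le_trans _ _ ((r ^- 2)%:E * (C1 * r `^ (2 - a))%:E)%E)//.
  by apply: lee_wpmul2l; [rewrite lee_fin|exact: H1].
rewrite -EFinM lee_fin powRD; last by apply/implyP => _; rewrite gt_eqF.
rewrite powR_mulrn ?(ltW r0)// le_eqVlt; apply/orP; left; apply/eqP.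
by field; rewrite gt_eqF.
Qed.

End kernel_bounds.

End jump_kernel.

(** * Second differences of functions of Hoelder class *)

Section holder_theory.
Context {R : realType} {d : nat}.
Local Notation rV := 'rV[R]_d.
Implicit Types x y z p : rV.

Lemma enormZ (c : R) x : enorm (c *: x) = `|c| * enorm x.
Proof.
rewrite /enorm (eq_bigr (fun i => c ^+ 2 * x ord0 i ^+ 2)); last first.
  by move=> i _; rewrite mxE exprMn.
by rewrite -mulr_sumr sqrtrM ?sqr_ge0// sqrtr_sqr.
Qed.

(** The compact sets on which the Hoelder condition is tested: cubes contain the segments between
    their points, as the mean value theorem requires, and membership is checked coordinatewise. *)
Definition cube (r : R) : set rV := [set x | forall i, `|x ord0 i| <= r].

Lemma compact_cube r : compact (cube r).
Proof.
rewrite (_ : cube r = [set v : rV | forall i, `[- r, r]%classic (v ord0 i)]).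
  by apply: (@rV_compact _ _ (fun=> `[- r, r]%classic)) => i; exact: segment_compact.
by apply/seteqP; split => x /= h i; have := h i; rewrite in_itv/= ler_norml.
Qed.

Lemma enorm_cube r x : cube r x -> enorm x <= Num.sqrt (d%:R * r ^+ 2).
Proof.
move=> xr; rewrite ler_sqrt; last by rewrite mulr_ge0 ?sqr_ge0.
apply: (@le_trans _ _ (\sum_(i < d) r ^+ 2)); last first.
  by rewrite sumr_const card_ord mulr_natl.
apply: ler_sum => i _; rewrite -real_normK ?num_real//.
by rewrite lerXn2r ?nnegrE// (le_trans _ (xr i)).
Qed.

Lemma cube_segment r x y (t : R) : cube r x -> cube r y -> 0 <= t <= 1 ->
  cube r (x + t *: (y - x)).
Proof.
move=> xr yr /andP[t0 t1] i; rewrite !mxE; have := xr i; have := yr i.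
rewrite !ler_norml => /andP[? ?] /andP[? ?].
by apply/andP; split; nra.
Qed.

Lemma is_derive_line (h : rV -> R) p z (t : R) :
  differentiable h (p + t *: z) ->
  is_derive t 1 (fun s : R => h (p + s *: z))
    (\sum_(i < d) z ord0 i * 'D_(delta_mx ord0 i) h (p + t *: z)).
Proof.
move=> dh.
have E : (fun s : R => s^-1 *: (((fun s : R => h (p + s *: z)) \o shift t) (s *: 1)
      - h (p + t *: z))) =
    (fun s : R => s^-1 *: ((h \o shift (p + t *: z)) (s *: z) - h (p + t *: z))).
  apply/funext => s /=; congr (_ *: (h _ - _)).
  by rewrite scalerDl addrCA [s *: 1]mulr1.
have dz : derivable h (p + t *: z) z by exact: diff_derivable.
apply: DeriveDef; first by rewrite /derivable E.
have -> : 'D_1 (fun s : R => h (p + s *: z)) t = 'D_z h (p + t *: z).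
  by rewrite /derive E.
move: dh; set q := p + t *: z => dh; rewrite deriveE//.
rewrite [X in 'd h q X = _](row_sum_delta z) linear_sum; apply: eq_bigr => i _.
by rewrite deriveE// linearZ.
Qed.

Lemma norm_grad_le (u v z : rV) (g : 'I_d -> rV -> R) (C : 'I_d -> R) (B : R) :
  (forall i, `|g i u - g i v| <= C i * B) -> (forall i, 0 <= C i) -> 0 <= B ->
  `|\sum_(i < d) z ord0 i * (g i u - g i v)| <= (\sum_(i < d) C i) * (B * enorm z).
Proof.
move=> gC C0 B0; rewrite (le_trans (ler_norm_sum _ _ _))// mulr_suml.
apply: ler_sum => i _; rewrite normrM mulrC mulrA.
by rewrite ler_pM// ler_coord_enorm.
Qed.

Lemma line_lipschitz (h : rV -> R) (B : 'I_d -> R) r : (forall i, 0 <= B i) ->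
  (forall x, cube r x -> differentiable h x) ->
  (forall i x, cube r x -> `|'D_(delta_mx ord0 i) h x| <= B i) ->
  forall x y, cube r x -> cube r y -> `|h x - h y| <= (\sum_i B i) * enorm (x - y).
Proof.
move=> B0 dh hB x y xr yr.
pose df (t : R) := \sum_(i < d) (x - y) ord0 i * 'D_(delta_mx ord0 i) h (y + t *: (x - y)).
have dline (t : R) : 0 <= t <= 1 ->
    is_derive t 1 (fun s : R => h (y + s *: (x - y))) (df t).
  by move=> t01; apply: is_derive_line; apply: dh; exact: cube_segment.
have [||c c01] := @MVT R (fun s : R => h (y + s *: (x - y))) df 0 1 ltr01.
- by move=> t; rewrite in_itv/= => /andP[t0 t1]; apply: dline; rewrite !ltW.
- apply: derivable_within_continuous => t; rewrite in_itv/= => t01.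
  exact: (@ex_derive _ _ _ _ _ _ _ (dline t t01)).
rewrite scale1r scale0r addr0 subr0 mulr1 subrKC => ->.
have cr : cube r (y + c *: (x - y)).
  by apply: cube_segment => //; move: c01; rewrite in_itv/= => /andP[? ?]; rewrite !ltW.
rewrite /df (le_trans (ler_norm_sum _ _ _))// mulr_suml.
apply: ler_sum => i _; rewrite normrM mulrC.
by rewrite ler_pM// ?hB// ler_coord_enorm.
Qed.

(** At order 0, a Hoelder function on a bounded set is bounded. Otherwise the induction bounds the
    partial derivatives, so the function is Lipschitz on the cube, hence bounded. *)
Lemma holder_deriv_bounded k t r (h : rV -> R) : 0 < t -> 0 <= r ->
  holder_deriv k t h (cube r) -> exists2 B : R, 0 <= B & forall x, cube r x -> `|h x| <= B.
Proof.
move=> t0 r0; have c0 : cube r 0 by move=> i; rewrite mxE normr0.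
elim: k h => [|k IH] h /=.
  move=> [C hC]; exists (`|h 0| + `|C| * Num.sqrt (d%:R * r ^+ 2) `^ t).
    by rewrite addr_ge0// mulr_ge0// powR_ge0.
  move=> x xr; rewrite -[h x](subrKC (h 0)) (le_trans (ler_normD _ _))// lerD2l.
  rewrite (le_trans (hC _ _ xr c0))// subr0.
  rewrite (@le_trans _ _ (`|C| * enorm x `^ t))//.
    by rewrite ler_wpM2r ?powR_ge0// ler_norm.
  rewrite ler_wpM2l//; apply: ge0_ler_powR; rewrite ?nnegrE ?sqrtr_ge0 ?(ltW t0)//.
  exact: enorm_cube.
move=> [dh /(_ _)hi].
have /choice[B HB] : forall i, exists B : R, 0 <= B /\
    forall x, cube r x -> `|'D_(delta_mx ord0 i) h x| <= B.
  by move=> i; have [B B0 HB] := IH _ (hi i); exists B.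
have lip := line_lipschitz (fun i => (HB i).1) dh (fun i => (HB i).2).
have S0 : 0 <= \sum_i B i by apply: sumr_ge0 => i _; have [] := HB i.
exists (`|h 0| + (\sum_i B i) * Num.sqrt (d%:R * r ^+ 2)).
  by rewrite addr_ge0// mulr_ge0// sqrtr_ge0.
move=> x xr; rewrite -[h x](subrKC (h 0)) (le_trans (ler_normD _ _))// lerD2l.
rewrite (le_trans (lip _ _ xr c0))// subr0 ler_wpM2l//.
exact: enorm_cube.
Qed.

Lemma holder_deriv_lipschitz k t r (h : rV -> R) : 0 < t -> 0 <= r ->
  holder_deriv k t h (cube r) -> exists2 C : R, 0 <= C & forall x y, cube r x -> cube r y ->
    `|h x - h y| <= C * enorm (x - y) `^ (if k is 0 then t else 1).
Proof.
move=> t0 r0; case: k => [|k].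
  move=> [C hC]; exists `|C| => // x y xr yr; rewrite (le_trans (hC _ _ xr yr))//.
  by rewrite ler_wpM2r ?powR_ge0// ler_norm.
move=> [dh hi].
have /choice[B HB] : forall i, exists B : R, 0 <= B /\
    forall x, cube r x -> `|'D_(delta_mx ord0 i) h x| <= B.
  by move=> i; have [B B0 HB] := holder_deriv_bounded t0 r0 (hi i); exists B.
have lip := line_lipschitz (fun i => (HB i).1) dh (fun i => (HB i).2).
exists (\sum_i B i); first by apply: sumr_ge0 => i _; have [] := HB i.
by move=> x y xr yr; rewrite powRr1 ?enorm_ge0//; exact: lip.
Qed.

(** The mean value theorem for [s |-> h (x + s z) + h (x - s z)], whose derivative pairs [z] with a
    difference of gradients at two points at most [2 * enorm z] apart; hence the factor [2 ^ t] and
    the exponent [1 + t]. *)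
Lemma gradient_second_difference (h : rV -> R) (C : 'I_d -> R) (t r : R) :
  0 <= t -> (forall i, 0 <= C i) ->
  (forall x, cube r x -> differentiable h x) ->
  (forall i x y, cube r x -> cube r y ->
    `|'D_(delta_mx ord0 i) h x - 'D_(delta_mx ord0 i) h y| <= C i * enorm (x - y) `^ t) ->
  forall x z, cube r (x + z) -> cube r (x - z) ->
    `|2 * h x - h (x + z) - h (x - z)| <= (\sum_i C i) * 2 `^ t * enorm z `^ (1 + t).
Proof.
move=> t0 C0 dh hC x z xzr xzr'.
pose D i := 'D_(delta_mx ord0 i) h.
pose df (s : R) := \sum_(i < d) z ord0 i * (D i (x + s *: z) - D i (x + s *: - z)).
have seg (s : R) : 0 <= s <= 1 -> cube r (x + s *: z) /\ cube r (x + s *: - z).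
  move=> /andP[s0 s1]; split => i; have := xzr i; have := xzr' i;
    rewrite !mxE !ler_norml => /andP[? ?] /andP[? ?]; apply/andP; split; nra.
have dline (s : R) : 0 <= s <= 1 ->
    is_derive s 1 ((fun s : R => h (x + s *: z)) + (fun s : R => h (x + s *: - z))) (df s).
  move=> /seg[s1 s2].
  have := is_deriveD (is_derive_line (dh _ s1)) (is_derive_line (dh _ s2)).
  congr is_derive; rewrite -big_split/=; apply: eq_bigr => i _.
  by rewrite mulrBr mxE mulNr.
have [||c c01] := @MVT R ((fun s : R => h (x + s *: z)) + (fun s : R => h (x + s *: - z))) df 0 1 ltr01.
- by move=> s; rewrite in_itv/= => /andP[s0 s1]; apply: dline; rewrite !ltW.
- apply: derivable_within_continuous => s; rewrite in_itv/= => s01.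
  exact: (@ex_derive _ _ _ _ _ _ _ (dline s s01)).
have {}c01 : 0 <= c <= 1 by move: c01; rewrite in_itv/= => /andP[? ?]; rewrite !ltW.
rewrite !fctE !scale1r !scale0r !addr0 subr0 mulr1 => E.
have -> : 2 * h x - h (x + z) - h (x - z) = - df c by rewrite -E; ring.
rewrite normrN.
have [c1 c2] := seg _ c01.
have := @norm_grad_le (x + c *: z) (x + c *: - z) z D C ((2 * enorm z) `^ t) _ C0 (powR_ge0 _ _).
have e2 : enorm (x + c *: z - (x + c *: - z)) <= 2 * enorm z.
  rewrite (_ : _ - _ = (2 * c) *: z).
    rewrite enormZ ger0_norm ?mulr_ge0//; last by case/andP: c01.
    by rewrite ler_wpM2r ?enorm_ge0// ler_piMr//; case/andP: c01.
  by apply/rowP => i; rewrite !mxE; ring.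
move=> /(_ _)/le_trans; apply.
  move=> i; rewrite (le_trans (hC i _ _ c1 c2))// ler_wpM2l//.
  by apply: ge0_ler_powR; rewrite ?nnegrE ?mulr_ge0 ?enorm_ge0.
rewrite le_eqVlt; apply/orP; left; apply/eqP.
rewrite powRM ?enorm_ge0// -!mulrA; congr (_ * (_ * _)).
have [->|z0] := eqVneq (enorm z) 0.
  by rewrite mulr0 powR0// gt_eqF// ltr_pwDl.
rewrite [RHS]powRD ?powRr1 ?enorm_ge0 1?mulrC//.
by apply/implyP.
Qed.

(** The exponent obtained always exceeds [a]: it is [t = a + g] at order 0, [1 + t = a + g] at order
    1, and 2 at higher orders, where the gradient is Lipschitz and [a < 2]. The cube of half-side
    [r + 1] leaves room for the increments [z]. *)
Lemma holder_plus_second_difference (a r : R) (h : rV -> R) : 0 < a < 2 -> 0 <= r ->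
  holder_plus a h -> exists s C : R, [/\ a < s, 0 <= C &
    forall x z, enorm x <= r -> enorm z <= 1 ->
      `|2 * h x - h (x + z) - h (x - z)| <= C * enorm z `^ s].
Proof.
move=> /andP[a0 a2] r0 /(_ _ (@compact_cube (r + 1)))[g g0 [k [t [/andP[t0 t1] agE hd]]]].
have r10 : 0 <= r + 1 by rewrite addr_ge0.
have inc x z : enorm x <= r -> enorm z <= 1 -> cube (r + 1) (x + z).
  move=> xr z1 i; rewrite mxE (le_trans (ler_normD _ _))// lerD//.
    exact: le_trans (ler_coord_enorm _ _) xr.
  exact: le_trans (ler_coord_enorm _ _) z1.
have incN x z : enorm x <= r -> enorm z <= 1 -> cube (r + 1) (x - z).
  by move=> xr z1; apply: inc; rewrite ?enormN.
have inc0 x : enorm x <= r -> cube (r + 1) x.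
  move=> xr i; rewrite (le_trans (ler_coord_enorm _ _))// (le_trans xr)// lerDl//.
case: k agE hd => [|k] agE hd.
  have [C C0 hC] := holder_deriv_lipschitz t0 r10 hd.
  exists t, (C + C); split; [by lra|by rewrite addr_ge0|move=> x z xr z1].
  rewrite (_ : _ - _ = (h x - h (x + z)) + (h x - h (x - z))); last by ring.
  rewrite (le_trans (ler_normD _ _))// mulrDl lerD//.
    rewrite (le_trans (hC _ _ (inc0 _ xr) (inc _ _ xr z1)))//.
    by rewrite opprD addrA subrr add0r enormN.
  rewrite (le_trans (hC _ _ (inc0 _ xr) (incN _ _ xr z1)))//.
  by rewrite opprB addrC subrK.
have [dh hi] := hd.
have /choice[C HC] : forall i, exists C : R, 0 <= C /\
    forall x y, cube (r + 1) x -> cube (r + 1) y ->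
    `|'D_(delta_mx ord0 i) h x - 'D_(delta_mx ord0 i) h y| <=
      C * enorm (x - y) `^ (if k is 0 then t else 1).
  by move=> i; have [C C0 HC] := holder_deriv_lipschitz t0 r10 (hi i); exists C.
pose t' : R := if k is 0 then t else 1.
have t'0 : 0 <= t' by rewrite /t'; case: (k) => //; exact: ltW.
exists (1 + t'), ((\sum_i C i) * 2 `^ t'); split.
- rewrite /t'; case: (k) agE => [|?] agE //; last by lra.
- by rewrite mulr_ge0 ?powR_ge0// sumr_ge0// => i _; have [] := HC i.
- move=> x z xr z1.
  apply: (gradient_second_difference t'0 (fun i => (HC i).1) dh (fun i => (HC i).2)).
    exact: inc.
  exact: incN.
Qed.

End holder_theory.

(** * Truncations of the fractional Laplacian *)

Section principal_value.
Context {R : realType}.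

(** [lim] is total, so existence of the limit belongs to the argument: the rate makes the family
    Cauchy at [0^'+], and passing to the limit in [e] keeps the bound. *)
Lemma cvg_at_right_rate (f : R -> R) (B q : R) : 0 <= B -> 0 < q ->
  (forall e e', 0 < e -> e < e' -> e' <= 1 -> `|f e - f e'| <= B * e' `^ q) ->
  forall e', 0 < e' -> e' <= 1 -> `|lim (f e @[e --> 0^'+]) - f e'| <= B * e' `^ q.
Proof.
move=> B0 q0 fB.
have cf : cvg (f e @[e --> 0^'+]).
  apply/cauchy_cvgP/cauchy_exP => _/posnumP[eps].
  have : (B * e `^ q) @[e --> 0^'+] --> B * 0.
    by apply: cvgM; [exact: cvg_cst|exact: powR_cvg0].
  rewrite mulr0 => /cvgrPdist_lt/(_ _ (gt0 eps)) hB.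
  near (0 : R)^'+ => e'.
  have e'0 : 0 < e' by near: e'; exact: nbhs_right_gt.
  have e'1 : e' <= 1 by near: e'; exact: nbhs_right_le.
  have e'B : B * e' `^ q < eps%:num.
    have : `|0 - B * e' `^ q| < eps%:num by near: e'.
    by rewrite sub0r normrN ger0_norm// mulr_ge0// powR_ge0.
  exists (f e'); change (\forall e \near (0 : R)^'+, ball (f e') eps%:num (f e)).
  near=> e.
  rewrite -ball_normE/= distrC (le_lt_trans _ e'B)//.
  exact: fB.
move=> e' e'0 e'1.
have : (fun e => `|f e - f e'|) @ 0^'+ --> `|lim (f e @[e --> 0^'+]) - f e'|.
  apply: cvg_norm; apply: cvgB; [exact: cf|exact: cvg_cst].
move=> /cvgr_to_le; apply; near=> e; exact: fB.
Unshelve. all: by end_near. Qed.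

Context {d : nat}.
Local Notation rV := 'rV[R]_d.
Local Notation mu := (@lebesgue_rV R d).
Implicit Types x y z : rV.

Lemma weight_gt0 (a : R) x : 0 < weight a x.
Proof. by rewrite invr_gt0 ltr_pwDl// powR_ge0. Qed.

Lemma measurable_enorm_rV : measurable_fun setT (enorm : rV -> R).
Proof. by apply: measurable_enorm => i; exact: measurable_coord_rV. Qed.

Lemma L1_weight_measurable (a : R) (u : rV -> R) :
  L1_weight a u -> measurable_fun setT u.
Proof.
move=> /integrableP[/measurable_EFinP mu' _].
rewrite (_ : u = fun x => u x * weight a x * (1 + enorm x `^ (d%:R + a))).
  apply: measurable_funM; first exact: mu'.
  apply: measurable_funD; first exact: measurable_cst.
  exact: (measurableT_comp (measurable_powR _) measurable_enorm_rV).
by apply/funext => x; rewrite /weight mulfVK// gt_eqF// ltr_pwDl// powR_ge0.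
Qed.

(** With [p = d + a], both 1 and [enorm y ^ p] must be bounded by multiples of [enorm (y - x) ^ p]
    where [enorm (y - x) > e]. The first multiple is [e ^ (- p)]; for the second, [enorm y <= 2 *
    (enorm x + enorm (y - x)) <= m * enorm (y - x)]. *)
Lemma jump_kernel_le_weight (a e : R) x : 0 < a -> 0 < e ->
  exists2 C : R, 0 < C & forall y, jump_kernel a e x y <= C * weight a y.
Proof.
move=> a0 e0; set p := d%:R + a.
have p0 : 0 < p by rewrite ltr_wpDl.
pose m := 2 * (enorm x / e + 1).
have m0 : 0 < m by rewrite mulr_gt0// ltr_wpDl// divr_ge0 ?enorm_ge0// ltW.
exists (e^-1 `^ p + m `^ p); first by rewrite addr_gt0// powR_gt0// invr_gt0.
move=> y; rewrite /jump_kernel; case: ifP => ey; last first.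
  rewrite mulr_ge0 ?ltW ?weight_gt0// addr_gt0// powR_gt0// invr_gt0//.
have yx0 : 0 < enorm (y - x) := lt_trans e0 ey.
rewrite powRN /weight -/p ler_pdivlMr; last by rewrite ltr_pwDl// powR_ge0.
rewrite mulrC ler_pdivrMr ?powR_gt0// mulrDl lerD//.
  rewrite -powRM ?invr_ge0 ?(ltW e0) ?(ltW yx0)//.
  rewrite -[leLHS](powRr0 (e^-1 * enorm (y - x))) ler_powR ?(ltW p0)//.
  by rewrite mulrC ler_pdivlMr// mul1r ltW.
rewrite -powRM ?(ltW m0) ?(ltW yx0)//.
apply: ge0_ler_powR; rewrite ?nnegrE ?enorm_ge0 ?(ltW p0) ?(ltW (mulr_gt0 m0 yx0))//.
have := ler_enormD2 x (y - x); rewrite subrKC => /le_trans; apply.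
rewrite /m -mulrA ler_pM2l// mulrDl mul1r lerD2r.
rewrite mulrAC ler_pdivlMr// ler_wpM2l ?enorm_ge0// ltW//.
Qed.

Section truncations.
Variables (a : R) (u : rV -> R).
Hypothesis a02 : 0 < a < 2.
Hypothesis u0 : forall x, 0 <= u x.
Hypothesis u1 : L1_weight a u.

Let a0 : 0 < a. Proof. by case/andP: a02. Qed.
Let mU : measurable_fun setT u. Proof. exact: L1_weight_measurable u1. Qed.
Local Notation k := (jump_kernel a).

Let muk e x : measurable_fun setT (fun y => u y * k e x y).
Proof. by apply: measurable_funM; [exact: mU|exact: measurable_jump_kernel]. Qed.

Let uk0 e x y : 0 <= u y * k e x y.
Proof. by rewrite mulr_ge0// jump_kernel_ge0. Qed.

Lemma integral_L1_kernel_lty e x : 0 < e ->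
  (\int[mu]_y (u y * k e x y)%:E < +oo)%E.
Proof.
move=> e0; have [C C0 HC] := jump_kernel_le_weight x a0 e0.
have mw : measurable_fun setT (fun y => u y * weight a y).
  by have /integrableP[/measurable_EFinP] := u1.
have uw0 y : 0 <= u y * weight a y by rewrite mulr_ge0// ltW// weight_gt0.
apply: (@le_lt_trans _ _ (\int[mu]_y (C * (u y * weight a y))%:E)%E).
  apply: le_integralT; [exact: muk| |].
    by apply: measurable_funM; [exact: measurable_cst|exact: mw].
  by move=> y; rewrite uk0/= mulrCA ler_wpM2l// HC.
rewrite integralTZl ?(ltW C0)//.
apply: lte_mul_pinfty; rewrite ?lee_fin ?(ltW C0)//.
have /integrableP[_] := u1; congr (_ < _)%E; apply: eq_integral => y _.
by rewrite /= ger0_norm.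
Qed.

Definition kernel_mass e x : R := fine (\int[mu]_y (k e x y)%:E).
Definition kernel_mean e x : R := fine (\int[mu]_y (u y * k e x y)%:E).

Lemma kernel_massE e x : 0 < e ->
  (\int[mu]_y (k e x y)%:E = (kernel_mass e x)%:E)%E.
Proof.
move=> e0; rewrite fineK// ge0_fin_numE ?jump_kernel_integral_lty//.
by apply: integralT_ge0 => y; exact: jump_kernel_ge0.
Qed.

Lemma kernel_meanE e x : 0 < e ->
  (\int[mu]_y (u y * k e x y)%:E = (kernel_mean e x)%:E)%E.
Proof.
by move=> e0; rewrite fineK// ge0_fin_numE ?integral_L1_kernel_lty// integralT_ge0.
Qed.

(** Both terms are finite integrals of nonnegative functions for [0 < e], so later estimates can
    treat them separately. *)
Definition truncated_laplacian e x : R := u x * kernel_mass e x - kernel_mean e x.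

Lemma truncated_laplacianE e x : 0 < e ->
  \int[mu]_(y in [set y | e < enorm (x - y)])
    ((u x - u y) / enorm (x - y) `^ (d%:R + a)) = truncated_laplacian e x.
Proof.
move=> e0; rewrite Rintegral_mkcond.
have ik : mu.-integrable setT (EFin \o (fun y => u x * k e x y)).
  apply/integrableP; split.
    apply/measurable_EFinP; apply: measurable_funM; first exact: measurable_cst.
    exact: measurable_jump_kernel.
  under eq_integral.
    move=> y _; rewrite /= ger0_norm; last by rewrite mulr_ge0 ?jump_kernel_ge0.
    over.
  rewrite integralTZl//; last 2 first.
  - exact: measurable_jump_kernel.
  - by move=> y; exact: jump_kernel_ge0.
  by rewrite kernel_massE// -EFinM ltry.
have iu : mu.-integrable setT (EFin \o (fun y => u y * k e x y)).
  apply/integrableP; split; first exact/measurable_EFinP/muk.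
  under eq_integral.
    by move=> y _; rewrite /= ger0_norm; [over|exact: uk0].
  by rewrite kernel_meanE// ltry.
transitivity (\int[mu]_y (u x * k e x y - u y * k e x y)).
  apply: eq_Rintegral => y _; rewrite /patch -mulrBl /jump_kernel.
  have [ey|ye] := ltP e (enorm (y - x)).
    by rewrite mem_set/= enormB// powRN.
  by rewrite memNset ?mulr0//= enormB; apply/negP; rewrite -leNgt.
rewrite RintegralB// /truncated_laplacian; congr (_ - _).
rewrite /Rintegral integralTZl//; last 2 first.
- exact: measurable_jump_kernel.
- by move=> y; exact: jump_kernel_ge0.
by rewrite kernel_massE.
Qed.

Variables (s C : R) (x : rV).
Hypothesis C0 : 0 <= C.
Hypothesis hC : forall z, enorm z <= 1 ->
  `|2 * u x - u (x + z) - u (x - z)| <= C * enorm z `^ s.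

(** Two truncations differ by an integral over the annulus between [e] and [e'], whose kernel [ann]
    is nonnegative and symmetric about [x]. The upper and lower second-difference estimates with
    [M = C / 2 * enorm (y - x) ^ s] then give the two sides of the bound. *)
Lemma truncated_laplacian_rate (B : R) :
  (forall e r, 0 < e -> 0 < r ->
    (\int[mu]_y ((if (enorm (y - x) <= r)%R then enorm (y - x) `^ s else 0%R)
      * k e x y)%:E <= (B * r `^ (s - a))%:E)%E) ->
  forall e e', 0 < e -> e < e' -> e' <= 1 ->
  `|truncated_laplacian e x - truncated_laplacian e' x| <= C / 2 * B * e' `^ (s - a).
Proof.
move=> hB e e' e0 ee' e'1; have e'0 := lt_trans e0 ee'.
pose near y := if enorm (y - x) <= e' then enorm (y - x) `^ s else 0.
pose M y := C / 2 * near y.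
pose ann y := k e x y - k e' x y.
have mk e1 : measurable_fun setT (k e1 x) by exact: measurable_jump_kernel.
have mann : measurable_fun setT ann by exact: measurable_funB.
have annE y : ann y = if e < enorm (y - x) <= e' then k e x y else 0.
  rewrite /ann /jump_kernel; have [ey|ey] /= := ltP e (enorm (y - x)); last first.
    by rewrite ifF ?subr0//; apply/negbTE; rewrite -leNgt (le_trans ey)// ltW.
  by have [ye'|ye'] := leP (enorm (y - x)) e'; rewrite ?subr0 ?subrr.
have ann0 y : 0 <= ann y by rewrite annE; case: ifP => // _; exact: jump_kernel_ge0.
have near0 y : 0 <= near y by rewrite /near; case: ifP => // _; exact: powR_ge0.
have mnear : measurable_fun setT near.
  apply: measurable_fun_ifT.
  - by apply: measurable_fun_ler; [exact: measurable_enormB|exact: measurable_cst].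
  - exact: (measurableT_comp (measurable_powR _) (measurable_enormB x)).
  - exact: measurable_cst.
have M0 y : 0 <= M y by rewrite mulr_ge0// divr_ge0.
have mM : measurable_fun setT M.
  by apply: measurable_funM; [exact: measurable_cst|exact: mnear].
have annr y : ann (x + x - y) = ann y by rewrite /ann !jump_kernel_reflect.
have annn y : ann y != 0 -> `|2 * u x - u y - u (x + x - y)| <= 2 * M y.
  rewrite annE; case: ifP => [/andP[ey ye'] _|]; last by rewrite eqxx.
  have := hC (le_trans ye' e'1).
  rewrite subrKC (_ : x - (y - x) = x + x - y); last by rewrite opprB addrA.
  move=> /le_trans; apply; rewrite /M /near ye' mulrA.
  by rewrite mulrCA divff ?mulr1.
have massE : (\int[mu]_y (ann y)%:E = (kernel_mass e x - kernel_mass e' x)%:E)%E.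
  have : (\int[mu]_y (k e x y)%:E = \int[mu]_y (ann y)%:E + \int[mu]_y (k e' x y)%:E)%E.
    rewrite -integralTD//; last by move=> y; exact: jump_kernel_ge0.
    by apply: eq_integral => y _; rewrite subrK.
  rewrite !kernel_massE//.
  by case: (\int[mu]_y _)%E => // r; rewrite -EFinD => -[->]; rewrite addrK.
have uann0 y : 0 <= u y * ann y by rewrite mulr_ge0.
have muann : measurable_fun setT (fun y => u y * ann y) by exact: measurable_funM.
have meanE : (\int[mu]_y (u y * ann y)%:E = (kernel_mean e x - kernel_mean e' x)%:E)%E.
  have : (\int[mu]_y (u y * k e x y)%:E = \int[mu]_y (u y * ann y)%:E + \int[mu]_y (u y * k e' x y)%:E)%E.
    rewrite -integralTD//.
    by apply: eq_integral => y _; rewrite /ann mulrBr subrK.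
  rewrite !kernel_meanE//.
  by case: (\int[mu]_y _)%E => // r; rewrite -EFinD => -[->]; rewrite addrK.
have MB : (\int[mu]_y (M y * ann y)%:E <= (C / 2 * B * e' `^ (s - a))%:E)%E.
  apply: (@le_trans _ _ (\int[mu]_y (C / 2 * (near y * k e x y))%:E)%E).
    apply: le_integralT.
    - exact: measurable_funM.
    - by apply: measurable_funM; [exact: measurable_cst|exact: measurable_funM].
    - move=> y; rewrite mulr_ge0//= /M -mulrA ler_wpM2l ?divr_ge0// ler_wpM2l//.
      by rewrite /ann gerBl jump_kernel_ge0.
  rewrite integralTZl; last by rewrite divr_ge0.
  2: exact: measurable_funM.
  2: by move=> y; rewrite mulr_ge0// jump_kernel_ge0.
  rewrite -[_ * B * _]mulrA [leRHS]EFinM.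
  by apply: lee_wpmul2l; [rewrite lee_fin divr_ge0|exact: hB].
have L1 := @second_difference_le _ _ x u ann M mU mann mM u0 ann0 M0 annr.
have L2 := @second_difference_ge _ _ x u ann M mU mann mM u0 ann0 M0 annr.
rewrite ler_norml; apply/andP; split.
  have : (\int[mu]_y (u y * ann y)%:E <=
    (u x)%:E * \int[mu]_y (ann y)%:E + (C / 2 * B * e' `^ (s - a))%:E)%E.
    apply: (le_trans (L2 _)); last exact: leeD2l.
    by move=> y /annn; rewrite ler_norml => /andP[+ _]; lra.
  rewrite massE meanE -EFinM -EFinD lee_fin /truncated_laplacian; lra.
have : ((u x)%:E * \int[mu]_y (ann y)%:E <= \int[mu]_y (u y * ann y)%:E +
   (C / 2 * B * e' `^ (s - a))%:E)%E.
  apply: (le_trans (L1 _)); last exact: leeD2l.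
  by move=> y /annn; rewrite ler_norml => /andP[_ +]; lra.
rewrite massE meanE -EFinM -EFinD lee_fin /truncated_laplacian; lra.
Qed.

End truncations.

(** Past this point the principal value is handled only through this comparison. It is uniform over
    the ball, so that it can be multiplied by the cap and integrated in [x] for one fixed [e]. *)
Lemma frac_laplacian_truncated (a r delta : R) (u : rV -> R) : 0 < a < 2 -> 0 <= r ->
  0 < delta -> (forall x, 0 <= u x) -> classical a u ->
  \forall e \near 0^'+, forall x, enorm x <= r ->
    frac_laplacian a u x <=
    @frac_laplacian_cst R d a * (truncated_laplacian a u e x + delta).
Proof.
move=> a02 r0 delta0 u0 [_ uh u1].
have [s [C [sa C0 hC]]] := holder_plus_second_difference a02 r0 uh.
have [B B0 hB] := @integral_near_kernel_le R d a s sa.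
have q0 : 0 < s - a by rewrite subr_gt0.
have D0 : 0 <= C / 2 * B by rewrite mulr_ge0 ?divr_ge0 ?(ltW B0).
have : (C / 2 * B * e `^ (s - a)) @[e --> 0^'+] --> C / 2 * B * 0.
  by apply: cvgM; [exact: cvg_cst|exact: powR_cvg0].
rewrite mulr0 => /cvgrPdist_lt/(_ _ delta0) hD.
near=> e.
have e0 : 0 < e by near: e; exact: nbhs_right_gt.
have e1 : e <= 1 by near: e; exact: nbhs_right_le.
have eD : C / 2 * B * e `^ (s - a) <= delta.
  have : `|0 - C / 2 * B * e `^ (s - a)| < delta by near: e.
  by rewrite sub0r normrN ger0_norm ?(mulr_ge0 D0) ?powR_ge0// => /ltW.
move=> x xr; rewrite /frac_laplacian.
rewrite ler_wpM2l//; first exact/ltW/frac_laplacian_cst_gt0.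
have -> : lim ((\int[mu]_(y in [set y | eps < enorm (x - y)])
    ((u x - u y) / enorm (x - y) `^ (d%:R + a))) @[eps --> 0^'+]) =
    lim (truncated_laplacian a u eps x @[eps --> 0^'+]).
  congr lim; apply/seteqP; split; apply: near_eq_cvg; near=> eps;
    rewrite truncated_laplacianE//; near: eps; exact: nbhs_right_gt.
have rate := truncated_laplacian_rate a02 u0 u1 C0 (fun z => hC x z xr) (fun e r => hB e x r).
have := cvg_at_right_rate D0 q0 rate e0 e1.
rewrite ler_norml => /andP[_]; lra.
Unshelve. all: by end_near. Qed.

End principal_value.

(** * The paraboloid cap *)

Section cap.
Context {R : realType} {d : nat}.
Local Notation rV := 'rV[R]_d.
Local Notation mu := (@lebesgue_rV R d).
Implicit Types x y z : rV.

Lemma compact_enorm_le (r : R) : compact [set x : rV | enorm x <= r].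
Proof.
apply: (subclosed_compact _ (@compact_cube R d r)).
  exact: ((continuous_closedP _).1 enorm_continuous _ (@closed_le R r)).
by move=> x /= xr i; exact: le_trans (ler_coord_enorm x i) xr.
Qed.

Definition cap (r : R) x : R := Num.max 0 (1 - (enorm x / r) ^+ 2).

Lemma cap_ge0 r x : 0 <= cap r x.
Proof. by rewrite le_max lexx. Qed.

Lemma cap_le1 r x : cap r x <= 1.
Proof. by rewrite ge_max ler01/= gerBl sqr_ge0. Qed.

Lemma cap_eq0 r x : 0 < r -> r <= enorm x -> cap r x = 0.
Proof.
move=> r0 rx; apply/max_idPl; rewrite subr_le0.
by rewrite expr_ge1// ?divr_ge0 ?enorm_ge0 ?(ltW r0)// ler_pdivlMr// mul1r.
Qed.

Lemma cap_ge34 r x : 0 < r -> enorm x <= r / 2 -> 3 / 4 <= cap r x.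
Proof.
move=> r0 xr; rewrite le_max; apply/orP; right.
have h : 0 <= enorm x / r <= 2^-1.
  by rewrite divr_ge0 ?enorm_ge0 ?(ltW r0)//= ler_pdivrMr// mulrC.
by move: h; move: (enorm x / r) => q /andP[q0 q1]; nra.
Qed.

Lemma continuous_cap r : continuous (cap r).
Proof.
have c1 : continuous (fun t : R => 1 - (t / r) ^+ 2 : R).
  move=> t; apply: cvgB; first exact: cvg_cst.
  apply: (@continuous_comp _ _ _ (fun t : R => t / r) (fun t : R => t ^+ 2)).
    exact: mulrr_continuous.
  exact: exprn_continuous.
move=> x; apply: (@continuous_max _ _ (cst 0) (fun x : rV => 1 - (enorm x / r) ^+ 2)).
  exact: (@cst_continuous _ _ (0 : R)).
apply: (@continuous_comp _ _ _ enorm (fun t : R => 1 - (t / r) ^+ 2)).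
  exact: enorm_continuous.
exact: c1.
Qed.

Lemma measurable_cap r : measurable_fun setT (cap r).
Proof.
apply: measurable_maxr; first exact: measurable_cst.
apply: measurable_funB; first exact: measurable_cst.
apply: measurable_funX; apply: measurable_funM; last exact: measurable_cst.
exact: measurable_enorm_rV.
Qed.

(** Where the cap vanishes at [x] the right-hand side is already nonnegative. Elsewhere it equals
    the paraboloid at [x] and dominates it at the two other points, and the second difference of the
    paraboloid is exact by the parallelogram law. For [enorm (y - x) > r] it is enough that the cap
    is at most 1. *)
Lemma cap_second_difference r x y : 0 < r ->
  2 * cap r x <= cap r y + cap r (x + x - y) + 2 * Num.min ((enorm (y - x) / r) ^+ 2) 1.
Proof.
move=> r0; have cy := cap_ge0 r y; have cxy := cap_ge0 r (x + x - y).
have [m1|m1] := leP ((enorm (y - x) / r) ^+ 2) 1; last first.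
  by have := cap_le1 r x; lra.
rewrite {1}/cap; have [xr|xr] := leP (1 - (enorm x / r) ^+ 2) 0.
  by rewrite mulr0 !addr_ge0// mulr_ge0// sqr_ge0.
have c1 : 1 - (enorm y / r) ^+ 2 <= cap r y by rewrite le_max lexx orbT.
have c2 : 1 - (enorm (x + x - y) / r) ^+ 2 <= cap r (x + x - y).
  by rewrite le_max lexx orbT.
have := enorm_parallelogram x (y - x).
rewrite subrKC opprB addrA => /(congr1 (fun t => t / r ^+ 2)).
by move: c1 c2; rewrite /= !expr_div_n; lra.
Qed.

(** An upper bound [C * r ^ (- a)] for the truncated operator applied to the cap, uniform in [e] and
    [x]. *)
Lemma cap_kernel_le (a : R) : 0 < a < 2 -> exists2 C : R, 0 < C &
  forall e r x, 0 < e -> 0 < r ->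
  ((cap r x)%:E * \int[mu]_y (jump_kernel a e x y)%:E <=
    \int[mu]_y (cap r y * jump_kernel a e x y)%:E + (C * r `^ (- a))%:E)%E.
Proof.
move=> a02; have [C C0 HC] := @integral_min_kernel_le R d a a02.
exists C => // e r x e0 r0.
apply: le_trans (leeD2l _ (HC e x r e0 r0)).
apply: second_difference_le.
- exact: measurable_cap.
- exact: measurable_jump_kernel.
- apply: measurable_minr; last exact: measurable_cst.
  apply: measurable_funX; apply: measurable_funM; last exact: measurable_cst.
  exact: measurable_enormB.
- exact: cap_ge0.
- by move=> y; exact: jump_kernel_ge0.
- by move=> y; rewrite le_min sqr_ge0 ler01.
- by move=> y; exact: jump_kernel_reflect.
- by move=> y _; exact: cap_second_difference.
Qed.

Lemma cap_indic r x : 0 < r -> cap r x <= \1_(eball (0 : rV) r) x.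
Proof.
move=> r0; rewrite indicE; have [xr|rx] := ltP (enorm x) r.
  by rewrite mem_set ?cap_le1// /eball/= subr0.
by rewrite (cap_eq0 r0 rx).
Qed.

End cap.

(** * Integral bound of the source *)

Section supersolution_estimates.
Context {R : realType} {d : nat}.
Local Notation rV := 'rV[R]_d.
Local Notation mu := (@lebesgue_rV R d).
Implicit Types (x y z : rV) (u G : rV -> R).

Lemma lebesgue_rV_integral_eball (r : R) x : 0 < r ->
  (\int[mu]_y (\1_(eball x r) y)%:E <= ((2 * r) ^+ d)%:E)%E.
Proof.
move=> r0; rewrite integral_indic//; last exact: measurable_eball.
by rewrite setIT; exact: lebesgue_rV_eball_le.
Qed.

Lemma continuous_bounded_enorm_le (r : R) u : 0 <= r -> continuous u ->
  (forall x, 0 <= u x) -> exists2 M : R, 0 <= M & forall x, enorm x <= r -> u x <= M.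
Proof.
move=> r0 cu u0.
have [||c _ hc] := @EVT_max_rV R d u [set x | enorm x <= r] _ (@compact_enorm_le R d r).
- by exists 0; rewrite /= /enorm big1 ?sqrtr0// => i _; rewrite mxE expr0n.
- exact: continuous_subspaceT.
by exists (u c) => // x xr; apply: hc; rewrite inE.
Qed.

Lemma kernel_mean_cap_lty (a e r : R) x : 0 < a < 2 -> 0 < e ->
  (\int[mu]_y (cap r y * jump_kernel a e x y)%:E < +oo)%E.
Proof.
move=> a02 e0; apply: le_lt_trans (jump_kernel_integral_lty a02 x e0).
apply: le_integralT.
- by apply: measurable_funM; [exact: measurable_cap|exact: measurable_jump_kernel].
- exact: measurable_jump_kernel.
- move=> y; rewrite mulr_ge0 ?cap_ge0 ?jump_kernel_ge0//=.
  by rewrite ler_piMl ?cap_le1 ?jump_kernel_ge0.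
Qed.

Lemma kernel_mean_capE (a e r : R) x : 0 < a < 2 -> 0 < e ->
  (\int[mu]_y (cap r y * jump_kernel a e x y)%:E = (kernel_mean a (cap r) e x)%:E)%E.
Proof.
move=> a02 e0; rewrite fineK// ge0_fin_numE ?kernel_mean_cap_lty// integralT_ge0// => y.
by rewrite mulr_ge0 ?cap_ge0 ?jump_kernel_ge0.
Qed.

Lemma cap_kernel_mass_le (a : R) : 0 < a < 2 -> exists2 C : R, 0 < C &
  forall e r x, 0 < e -> 0 < r ->
  cap r x * kernel_mass a e x <= kernel_mean a (cap r) e x + C * r `^ (- a).
Proof.
move=> a02; have [C C0 HC] := @cap_kernel_le R d a a02; exists C => // e r x e0 r0.
have := HC e r x e0 r0.
by rewrite kernel_mean_capE// kernel_massE// -EFinM -EFinD lee_fin.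
Qed.

Let measurable_section_integral (F : rV -> rV -> R) :
  measurable_fun setT (fun p : rV * rV => F p.1 p.2) -> (forall x y, 0 <= F x y) ->
  measurable_fun setT (fun x => \int[mu]_y (F x y)%:E)%E.
Proof.
move=> mF F0.
have mF' : measurable_fun setT (fun p : rV * rV => (F p.1 p.2)%:E).
  exact/measurable_EFinP.
exact: (@measurable_fun_fubini_tonelli_F _ _ _ _ R mu (fun p => (F p.1 p.2)%:E) mF' (fun p => F0 p.1 p.2)).
Qed.

Let exchange_integral (F : rV -> rV -> R) :
  measurable_fun setT (fun p : rV * rV => F p.1 p.2) -> (forall x y, 0 <= F x y) ->
  (\int[mu]_x \int[mu]_y (F x y)%:E = \int[mu]_y \int[mu]_x (F x y)%:E)%E.
Proof.
move=> mF F0.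
have mF' : measurable_fun setT (fun p : rV * rV => (F p.1 p.2)%:E).
  exact/measurable_EFinP.
exact: (@fubini_tonelli _ _ _ _ R mu mu (fun p => (F p.1 p.2)%:E) mF' (fun p => F0 p.1 p.2)).
Qed.

(** Formally the operator is moved from [u] to the cap. In truncated form, [cap * mean] and
    [u * capmean] have equal integrals and cancel; what is left is the bound for the cap, which
    costs [C * r ^ (- a) * u] on the ball and nothing outside. *)
Lemma integral_source_le (a : R) : 0 < a < 2 -> exists2 C : R, 0 < C &
  forall r u G, 0 < r -> classical a u -> (forall x, 0 <= u x) ->
  measurable_fun setT G -> (forall x, 0 <= G x) ->
  (forall x, G x <= frac_laplacian a u x) ->
  (\int[mu]_x (cap r x * G x)%:E <=
   (C * r `^ (- a))%:E * \int[mu]_x (u x * \1_(eball (0%R : rV) r) x)%:E)%E.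
Proof.
move=> a02; have a0 : 0 < a by case/andP: a02.
have [C C0 HC] := cap_kernel_mass_le a02.
have c0 := @frac_laplacian_cst_gt0 R d a a02.
set c := frac_laplacian_cst a in c0.
exists (c * C) => [|r u G r0 clu u0 mG G0 GL]; first exact: mulr_gt0.
have [cu _ u1] := clu.
have mu' := L1_weight_measurable u1.
pose b : rV -> R := \1_(eball (0 : rV) r).
have b01 x : 0 <= b x <= 1 by rewrite /b indicE; case: (_ \in _); rewrite ?lexx ler01.
have mb : measurable_fun setT b by apply: measurable_indic; exact: measurable_eball.
have bP x : b x != 0 -> b x = 1 by rewrite /b indicE; case: (_ \in _); rewrite ?eqxx.
have bint : (\int[mu]_x (b x)%:E <= ((2 * r) ^+ d)%:E)%E := lebesgue_rV_integral_eball 0 r0.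
have cap_le_b x : cap r x <= b x by exact: cap_indic.
have capb x : b x = 0 -> cap r x = 0.
  by move=> bx; apply/eqP; rewrite eq_le cap_ge0 andbT -bx cap_le_b.
have capr x : cap r x != 0 -> enorm x <= r.
  by apply: contraNT; rewrite -ltNge => /ltW rx; rewrite (cap_eq0 r0 rx).
have mcap := @measurable_cap R d r.
rewrite -/b; clearbody b.
have ub0 x : 0 <= u x * b x by rewrite mulr_ge0//; case/andP: (b01 x).
have mub : measurable_fun setT (fun x => u x * b x) by exact: measurable_funM.
have capG0 x : 0 <= cap r x * G x by rewrite mulr_ge0// cap_ge0.
have mcapG : measurable_fun setT (fun x => cap r x * G x) by exact: measurable_funM.
suff key : ((c^-1)%:E * \int[mu]_x (cap r x * G x)%:E <=
   (C * r `^ (- a))%:E * \int[mu]_x (u x * b x)%:E)%E.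
  have := lee_wpmul2l (ltW (c0 : (0 < c%:E)%E)) key.
  rewrite muleA -EFinM divff ?gt_eqF// mul1e => /le_trans; apply.
  by rewrite muleA -EFinM mulrA.
apply/lee_addgt0Pr => eps eps0.
pose V : R := (2 * r) ^+ d; have V0 : 0 < V by rewrite exprn_gt0// mulr_gt0.
(* [V] bounds the volume of the ball, so the truncation error integrates to at most [eps]. *)
pose delta := eps / V; have delta0 : 0 < delta by rewrite divr_gt0.
have := frac_laplacian_truncated a02 (ltW r0) delta0 u0 clu.
rewrite -/c => hL; near (0 : R)^'+ => e.
have e0 : 0 < e by near: e; exact: nbhs_right_gt.
have hL' x : enorm x <= r -> frac_laplacian a u x <= c * (truncated_laplacian a u e x + delta).
  by move: x; near: e; exact: hL.
pose mean := kernel_mean a u e; pose mass := @kernel_mass R d a e.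
pose capmean := kernel_mean a (@cap R d r) e.
have [C2 C20 HC2] := @jump_kernel_mass_le R d a a02.
have massC x : mass x <= C2 * e `^ (- a).
  by have := HC2 e x e0; rewrite kernel_massE// lee_fin.
have mass0 x : 0 <= mass x.
  by rewrite fine_ge0// integralT_ge0// => y; exact: jump_kernel_ge0.
have mean0 x : 0 <= mean x.
  by rewrite fine_ge0// integralT_ge0// => y; rewrite mulr_ge0// jump_kernel_ge0.
have capmean0 x : 0 <= capmean x.
  by rewrite fine_ge0// integralT_ge0// => y; rewrite mulr_ge0 ?cap_ge0// jump_kernel_ge0.
(* The truncated super-solution inequality multiplied by the cap, arranged so that all terms are
   nonnegative. *)
have p1 x : c^-1 * (cap r x * G x) + cap r x * mean x <= u x * (cap r x * mass x) + delta * cap r x.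
  have [->|/capr xr] := eqVneq (cap r x) 0; first by rewrite !mul0r !mulr0.
  have : G x / c <= truncated_laplacian a u e x + delta.
    by rewrite ler_pdivrMr// mulrC (le_trans (GL x))// hL'.
  rewrite /truncated_laplacian -/(mass x) -/(mean x) => h.
  by have := ler_wpM2l (cap_ge0 r x) h; lra.
(* Off the ball the left-hand side is zero, which expresses that the operator applied to the cap is
   nonpositive there. *)
have p2 x : u x * (cap r x * mass x) <= u x * capmean x + C * r `^ (- a) * (u x * b x).
  have [b0|b0] := eqVneq (b x) 0.
    by rewrite (capb _ b0) b0 mul0r !mulr0 addr0 mulr_ge0.
  by rewrite (bP _ b0); have := ler_wpM2l (u0 x) (HC e r x e0 r0); rewrite -/(mass x) -/(capmean x); lra.
pose F x y := cap r x * (u y * jump_kernel a e x y).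
have F0 x y : 0 <= F x y by rewrite !mulr_ge0 ?cap_ge0 ?jump_kernel_ge0.
have mF : measurable_fun setT (fun p : rV * rV => F p.1 p.2).
  apply: measurable_funM; first exact: (measurableT_comp mcap measurable_fst).
  apply: measurable_funM; first exact: (measurableT_comp mu' measurable_snd).
  exact: measurable_jump_kernel2.
have FE x : (\int[mu]_y (F x y)%:E = (cap r x * mean x)%:E)%E.
  rewrite /F integralTZl; [|by apply: measurable_funM; [exact: mu'|exact: measurable_jump_kernel]| |exact: cap_ge0].
    by rewrite kernel_meanE.
  by move=> y; rewrite mulr_ge0// jump_kernel_ge0.
have FE' y : (\int[mu]_x (F x y)%:E = (u y * capmean y)%:E)%E.
  under eq_integral do rewrite /F mulrCA jump_kernelC.
  rewrite integralTZl; [|by apply: measurable_funM; [exact: mcap|exact: measurable_jump_kernel]| |exact: u0].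
    by rewrite kernel_mean_capE.
  by move=> x; rewrite mulr_ge0 ?cap_ge0// jump_kernel_ge0.
have mcm : measurable_fun setT (fun x => cap r x * mean x).
  by have := measurable_section_integral mF F0; under eq_fun do rewrite FE; move/measurable_EFinP.
have muc : measurable_fun setT (fun y => u y * capmean y).
  have mF' : measurable_fun setT (fun p : rV * rV => F p.2 p.1).
    exact: (measurableT_comp mF (measurable_fun_pair measurable_snd measurable_fst)).
  have := measurable_section_integral mF' (fun x y => F0 y x).
  by under eq_fun do rewrite FE'; move/measurable_EFinP.
(* Integration by parts: both sides are iterated integrals of [F], by symmetry of the kernel. *)
have BB : (\int[mu]_x (cap r x * mean x)%:E = \int[mu]_y (u y * capmean y)%:E)%E.
  transitivity (\int[mu]_x \int[mu]_y (F x y)%:E)%E.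
    by apply: eq_integral => x _; rewrite FE.
  by rewrite (exchange_integral mF F0); apply: eq_integral => y _; exact: FE'.
clearbody mean mass capmean; clear F F0 mF FE FE'.
have cm0 x : 0 <= cap r x * mean x by rewrite mulr_ge0// cap_ge0.
have uc0 x : 0 <= u x * capmean x by rewrite mulr_ge0.
(* The common term must be finite to be cancelled. By [p1] it is dominated on the ball by a constant
   depending on [e], since [u] is bounded there and the kernel mass is at most [C2 * e ^ (- a)]. *)
have Bfin : (\int[mu]_x (cap r x * mean x)%:E \is a fin_num)%E.
  rewrite ge0_fin_numE; last exact: integralT_ge0.
  have [M M0 uM] := continuous_bounded_enorm_le (ltW r0) cu u0.
  pose D := M * (C2 * e `^ (- a)) + delta.
  have D0 : 0 <= D by rewrite addr_ge0 ?(ltW delta0)// !mulr_ge0 ?powR_ge0 ?(ltW C20).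
  apply: (@le_lt_trans _ _ (\int[mu]_x (D * b x)%:E)%E).
    apply: le_integralT.
    - exact: mcm.
    - by apply: measurable_funM; [exact: measurable_cst|exact: mb].
    move=> x; rewrite cm0/=.
    have [b0|b0] := eqVneq (b x) 0; first by rewrite (capb _ b0) b0 mul0r mulr0.
    rewrite (bP _ b0).
    have [->|capx] := eqVneq (cap r x) 0; first by rewrite mul0r mulr1.
    have xr := capr _ capx.
    have : cap r x * mean x <= u x * (cap r x * mass x) + delta * cap r x.
      by apply: le_trans (p1 x); rewrite lerDr mulr_ge0// invr_ge0 ltW.
    move=> /le_trans; apply; rewrite mulr1 lerD//.
      by rewrite ler_pM ?mulr_ge0 ?cap_ge0 ?uM// (le_trans _ (massC x))// ler_piMl ?cap_le1.
    by rewrite ler_piMr ?cap_le1// ltW.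
  rewrite integralTZl; [|exact: mb|by move=> x; case/andP: (b01 x)|exact: D0].
  apply: lte_mul_pinfty; rewrite ?lee_fin//.
  exact: le_lt_trans bint (ltry _).
have c1 : 0 <= c^-1 by rewrite invr_ge0 ltW.
have CR0 : 0 <= C * r `^ (- a) by rewrite mulr_ge0 ?powR_ge0// ltW.
have d0 : 0 <= delta by exact: ltW.
have mono : (\int[mu]_x (c^-1 * (cap r x * G x) + cap r x * mean x)%:E <=
   \int[mu]_x (u x * capmean x + (C * r `^ (- a) * (u x * b x) + delta * cap r x))%:E)%E.
  apply: le_integralT.
  - by apply: measurable_funD; [apply: measurable_funM; [exact: measurable_cst|exact: mcapG]|exact: mcm].
  - apply: measurable_funD; first exact: muc.
    by apply: measurable_funD; apply: measurable_funM; [exact: measurable_cst|exact: mub|exact: measurable_cst|exact: mcap].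
  - move=> x; rewrite addr_ge0 ?(mulr_ge0 c1)//=.
    by have := p1 x; have := p2 x; lra.
have m1 : measurable_fun setT (fun x => c^-1 * (cap r x * G x)).
  by apply: measurable_funM; [exact: measurable_cst|exact: mcapG].
have m2 : measurable_fun setT (fun x => C * r `^ (- a) * (u x * b x)).
  by apply: measurable_funM; [exact: measurable_cst|exact: mub].
have m3 : measurable_fun setT (fun x => delta * cap r x).
  by apply: measurable_funM; [exact: measurable_cst|exact: mcap].
have n1 x : 0 <= c^-1 * (cap r x * G x) by rewrite mulr_ge0.
have n2 x : 0 <= C * r `^ (- a) * (u x * b x) by rewrite mulr_ge0.
have n3 x : 0 <= delta * cap r x by rewrite mulr_ge0 ?cap_ge0.
move: mono; rewrite integralTD; [|exact: m1|exact: mcm|exact: n1|exact: cm0].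
rewrite integralTD; [|exact: muc|exact: measurable_funD|exact: uc0|by move=> x; rewrite addr_ge0].
rewrite integralTD; [|exact: m2|exact: m3|exact: n2|exact: n3].
rewrite BB addeC leeD2lE -?BB// => mono.
rewrite -integralTZl; [|exact: mcapG|exact: capG0|exact: c1].
apply: (le_trans mono); apply: leeD.
  by rewrite integralTZl; [|exact: mub|exact: ub0|exact: CR0].
rewrite integralTZl; [|exact: mcap|exact: cap_ge0|exact: d0].
apply: (@le_trans _ _ (delta%:E * V%:E)%E); last first.
  by rewrite -EFinM /delta divfK// gt_eqF.
apply: lee_wpmul2l; first by rewrite lee_fin.
apply: le_trans bint.
by apply: le_integralT; [exact: mcap|exact: mb|move=> x; rewrite cap_ge0 cap_le_b].
Unshelve. all: by end_near. Qed.

End supersolution_estimates.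

(** * Weak Harnack inequality *)

Section weak_harnack.
Context {R : realType} {d : nat}.
Local Notation rV := 'rV[R]_d.
Local Notation mu := (@lebesgue_rV R d).
Implicit Types (x y z : rV) (u G : rV -> R).

(* The function [u - 2 (u x0) cap] attains a nonpositive minimum on the ball; at
   the contact point the fractional Laplacian of [u] is comparable with that of
   the cap, up to the integral of the nonnegative gap between the two sides. *)
Lemma weak_harnack (a : R) : (0 < d)%N -> 0 < a < 2 -> exists2 C : R, 0 < C &
  forall r u, 0 < r -> classical a u -> (forall x, 0 <= u x) ->
  (forall x, 0 <= frac_laplacian a u x) -> forall x0, enorm x0 <= r ->
  (\int[mu]_y (u y * \1_(eball (0%R : rV) (2 * r)) y)%:E <=
   (C * r ^+ d * u x0)%:E)%E.
Proof.
move=> hd a02; have a0 : 0 < a by case/andP: a02.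
have [C0 C00 HC] := @cap_kernel_mass_le R d a a02.
have c0 := @frac_laplacian_cst_gt0 R d a a02.
(* The first term is [2 * m] times the volume bound of the ball of radius [2 * r]; the second is
   [P * (2 * m * C0 * rho ^ (- a))], with [m], [rho] and [P] as below, divided by [m * r ^+ d]. *)
pose C : R := 2 * 4 ^+ d + 2 * (8 `^ (d%:R + a) * 2 `^ (- a)) * C0.
exists C => [|r u r0 clu u0 L0 x0 x0r].
  by rewrite addr_gt0// !mulr_gt0 ?exprn_gt0 ?powR_gt0.
have [cu _ u1] := clu; have mu' := L1_weight_measurable u1.
pose m := u x0; have m0 : 0 <= m := u0 x0.
pose rho := 2 * r; have rho0 : 0 < rho by rewrite mulr_gt0.
(* Two points of the ball of radius [rho] are at most [4 * rho] apart by the factor-2 triangle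
   inequality, so the kernel is at least [P^-1] between them beyond distance [e]. *)
pose P : R := (4 * rho) `^ (d%:R + a); have P0 : 0 < P by rewrite powR_gt0// mulr_gt0.
apply/lee_addgt0Pr => eps eps0.
pose delta := eps / (P + 1).
have P10 : 0 < P + 1 by rewrite addr_gt0.
have delta0 : 0 < delta by rewrite divr_gt0.
(* As [rho = 2 * r], the cap is at least 3/4 at [x0], whence [w x0 <= m - (3 / 2) * m <= 0]. *)
pose w x := u x - 2 * m * cap rho x.
have [||xs] := @EVT_min_rV R d w [set x | enorm x <= rho] _ (@compact_enorm_le R d rho).
- by exists x0 => /=; rewrite (le_trans x0r)// /rho ler_peMl ?(ltW r0)// ler1n.
- apply: continuous_subspaceT => x.
  apply: (@continuousB _ _ _ u (fun y => 2 * m * cap rho y) x); first exact: cu.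
  apply: (@continuous_comp _ _ _ (cap rho) (fun t : R => 2 * m * t)).
    exact: continuous_cap.
  exact: mulrl_continuous.
rewrite inE/= => xsr wmin.
have ws0 : w xs <= 0.
  have x0rho : enorm x0 <= rho by rewrite (le_trans x0r)// /rho ler_peMl ?(ltW r0)// ler1n.
  have := wmin x0; rewrite inE => /(_ x0rho) /le_trans; apply.
  have c34 : 3 / 4 <= cap rho x0.
    by apply: cap_ge34 => //; rewrite /rho mulrAC divff ?mul1r.
  by rewrite /w -/m; have := ler_wpM2l m0 c34; lra.
(* Nonnegative everywhere: inside the ball by minimality, outside because [w = u >= 0 >= w xs]. It
   controls [u] up to [2 * m]. *)
pose g y := w y - w xs.
have g0 y : 0 <= g y.
  rewrite subr_ge0; have [yr|yr] := leP (enorm y) rho; first by apply: wmin; rewrite inE.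
  by rewrite (le_trans ws0)// /w cap_eq0 ?(ltW yr)// mulr0 subr0.
have ug y : u y <= 2 * m + g y.
  have : 2 * m * cap rho y <= 2 * m by rewrite ler_piMr ?cap_le1// mulr_ge0.
  by rewrite /g /w; move: ws0; rewrite /w; lra.
have mcap := @measurable_cap R d rho.
have mw : measurable_fun setT w.
  apply: measurable_funB; first exact: mu'.
  by apply: measurable_funM; [exact: measurable_cst|exact: mcap].
have mg : measurable_fun setT g by apply: measurable_funB; [exact: mw|exact: measurable_cst].
have [M M0 uM] := continuous_bounded_enorm_le (ltW rho0) cu u0.
have hL := frac_laplacian_truncated a02 (ltW rho0) delta0 u0 clu.
(* The truncated kernel says nothing within distance [e] of the contact point; there [u <= M], and a
   ball of volume at most [(4 * e) ^ d] is made negligible. *)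
have hM : \forall e \near (0 : R)^'+, M * 4 ^+ d * e `^ d%:R <= delta.
  have : (M * 4 ^+ d * e `^ d%:R) @[e --> 0^'+] --> M * 4 ^+ d * 0.
    by apply: cvgM; [exact: cvg_cst|apply: powR_cvg0; rewrite ltr0n].
  rewrite mulr0 => /cvgrPdist_lt/(_ _ delta0); apply: filterS => e.
  by rewrite sub0r normrN => /ltW/ler_normlW.
near (0 : R)^'+ => e.
have e0 : 0 < e by near: e; exact: nbhs_right_gt.
have hMe : M * 4 ^+ d * e `^ d%:R <= delta by near: e; exact: hM.
have hLe : frac_laplacian a u xs <=
    @frac_laplacian_cst R d a * (truncated_laplacian a u e xs + delta).
  by move: xs xsr {ws0 wmin g g0 ug mg}; near: e; exact: hL.
have TL0 : 0 <= truncated_laplacian a u e xs + delta.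
  by rewrite -(pmulr_rge0 _ c0) (le_trans (L0 xs) hLe).
have mk := @measurable_jump_kernel R d a e xs.
have k0 y := @jump_kernel_ge0 R d a e xs y.
(* Integrate [u y + 2 m cap xs = u xs + 2 m cap y + g y] against the kernel: the terms in [u]
   contribute at most [delta], as the truncated operator at [xs] is at least [- delta], and the
   terms in the cap at most [2 * m * C0 * rho ^ (- a)]. *)
have keyg : (\int[mu]_y (g y * jump_kernel a e xs y)%:E <=
    (delta + 2 * m * (C0 * rho `^ (- a)))%:E)%E.
  have m1 : measurable_fun setT (fun y => u y * jump_kernel a e xs y) by exact: measurable_funM.
  have m2 : measurable_fun setT (fun y => cap rho y * jump_kernel a e xs y) by exact: measurable_funM.
  have m3 : measurable_fun setT (fun y => g y * jump_kernel a e xs y) by exact: measurable_funM.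
  have mZ (t : R) (h : rV -> R) : measurable_fun setT h -> measurable_fun setT (fun y => t * h y).
    by move=> mh; apply: measurable_funM; [exact: measurable_cst|exact: mh].
  have n1 y : 0 <= u y * jump_kernel a e xs y by rewrite mulr_ge0.
  have n2 y : 0 <= cap rho y * jump_kernel a e xs y by rewrite mulr_ge0// cap_ge0.
  have n3 y : 0 <= g y * jump_kernel a e xs y by rewrite mulr_ge0.
  have m20 : 0 <= 2 * m by rewrite mulr_ge0.
  have mc0 : 0 <= 2 * m * cap rho xs by rewrite mulr_ge0// cap_ge0.
  have : (\int[mu]_y (u y * jump_kernel a e xs y + 2 * m * cap rho xs * jump_kernel a e xs y)%:E =
    \int[mu]_y (u xs * jump_kernel a e xs y + (2 * m * (cap rho y * jump_kernel a e xs y) +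
        g y * jump_kernel a e xs y))%:E)%E.
    by apply: eq_integral => y _; congr EFin; rewrite /g /w; ring.
  rewrite integralTD; [|exact: m1|exact: mZ|exact: n1|by move=> y; rewrite mulr_ge0].
  rewrite integralTZl; [|exact: mk|exact: k0|exact: mc0].
  rewrite integralTD; [|exact: mZ|by apply: measurable_funD; [exact: mZ|exact: m3]
     |by move=> y; rewrite mulr_ge0|by move=> y; rewrite addr_ge0// mulr_ge0].
  rewrite integralTZl; [|exact: mk|exact: k0|exact: u0].
  rewrite integralTD; [|exact: mZ|exact: m3|by move=> y; rewrite mulr_ge0|exact: n3].
  rewrite integralTZl; [|exact: m2|exact: n2|exact: m20].
  rewrite (kernel_meanE a02 u0 u1 xs e0) (kernel_massE a02 xs e0) (kernel_mean_capE rho xs a02 e0).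
  have := HC e rho xs e0 rho0.
  move: TL0; rewrite /truncated_laplacian.
  case: (\int[mu]_y _)%E => // t TL0 hcap [] E; rewrite lee_fin.
  have := ler_wpM2l m20 hcap.
  lra.
pose b : rV -> R := \1_(eball (0 : rV) rho).
have b01 y : b y = 0 \/ b y = 1 by rewrite /b indicE; case: (_ \in _); [right|left].
have b0 y : 0 <= b y by have [->|->] := b01 y.
have br y : b y = 1 -> enorm y <= rho.
  rewrite /b indicE; case: (boolP (y \in _)) => [|_ /eqP]; last by rewrite eq_sym oner_eq0.
  by rewrite inE /eball/= subr0 => /ltW.
have mb : measurable_fun setT b by apply: measurable_indic; exact: measurable_eball.
have bint := @lebesgue_rV_integral_eball R d rho 0 rho0.
rewrite -/b in bint *.
pose s : rV -> R := \1_(eball xs (2 * e)).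
have e20 : 0 < 2 * e by rewrite mulr_gt0.
have ms : measurable_fun setT s by apply: measurable_indic; exact: measurable_eball.
have s0 y : 0 <= s y by rewrite /s indicE.
have s1 y : enorm (y - xs) <= e -> s y = 1.
  by move=> ye; rewrite /s indicE mem_set//= /eball/= (le_lt_trans ye)// ltr_pMl// ltr1n.
have sint := @lebesgue_rV_integral_eball R d (2 * e) xs e20.
rewrite -/s in sint.
clearbody b s.
have pw : forall y,
    u y * b y <= 2 * m * b y + (P * (g y * jump_kernel a e xs y) + M * s y).
  move=> y.
  have gk0 : 0 <= P * (g y * jump_kernel a e xs y) by rewrite !mulr_ge0 ?(ltW P0).
  have Ms0 : 0 <= M * s y by rewrite mulr_ge0.
  have [by0|by1] := b01 y; first by rewrite by0 !mulr0 add0r addr_ge0.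
  rewrite by1 !mulr1; have yr := br _ by1.
  have [ye|ye] := leP (enorm (y - xs)) e.
    by have := uM y yr; rewrite (s1 _ ye) mulr1; move: m0 gk0; lra.
  rewrite (le_trans (ug y))// lerD2l -[leLHS]addr0 lerD//.
  rewrite mulrCA ler_peMr// /jump_kernel ye powRN /P.
  have yx0 : 0 < enorm (y - xs) := lt_trans e0 ye.
  rewrite ler_pdivlMr ?powR_gt0// mul1r.
  apply: ge0_ler_powR; rewrite ?nnegrE ?(ltW yx0) ?(ltW (mulr_gt0 _ rho0))//.
    by rewrite addr_ge0// ltW.
  have := ler_enormD2 y (- xs); rewrite enormN.
  by move: yr xsr; lra.
have mZ (t : R) (h : rV -> R) : measurable_fun setT h -> measurable_fun setT (fun y => t * h y).
  by move=> mh; apply: measurable_funM; [exact: measurable_cst|exact: mh].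
have mgk : measurable_fun setT (fun y => g y * jump_kernel a e xs y) by exact: measurable_funM.
have ngk y : 0 <= g y * jump_kernel a e xs y by rewrite mulr_ge0.
clearbody g.
apply: (@le_trans _ _ (\int[mu]_y (2 * m * b y + (P * (g y * jump_kernel a e xs y) + M * s y))%:E)%E).
  apply: le_integralT.
  - by apply: measurable_funM; [exact: mu'|exact: mb].
  - apply: measurable_funD; first exact: mZ.
    by apply: measurable_funD; exact: mZ.
  - by move=> y; rewrite pw mulr_ge0.
have m20 : 0 <= 2 * m by rewrite mulr_ge0.
have P00 := ltW P0.
rewrite integralTD; [|exact: mZ|by apply: measurable_funD; exact: mZ
  |by move=> y; rewrite mulr_ge0|by move=> y; rewrite addr_ge0// mulr_ge0].
rewrite integralTD; [|exact: mZ|exact: mZ|by move=> y; rewrite mulr_ge0|by move=> y; rewrite mulr_ge0].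
rewrite integralTZl; [|exact: mb|exact: b0|exact: m20].
rewrite integralTZl; [|exact: mgk|exact: ngk|exact: P00].
rewrite integralTZl; [|exact: ms|exact: s0|exact: M0].
apply: (@le_trans _ _ ((2 * m)%:E * ((2 * rho) ^+ d)%:E +
   (P%:E * (delta + 2 * m * (C0 * rho `^ (- a)))%:E + M%:E * ((2 * (2 * e)) ^+ d)%:E))%E).
  apply: leeD; first by apply: lee_wpmul2l; [rewrite lee_fin|exact: bint].
  apply: leeD; first by apply: lee_wpmul2l; [rewrite lee_fin|exact: keyg].
  by apply: lee_wpmul2l; [rewrite lee_fin|exact: sint].
rewrite -!EFinM -!EFinD lee_fin.
have h1 : M * (2 * (2 * e)) ^+ d <= delta.
  apply: le_trans hMe; rewrite mulrA exprMn powR_mulrn ?(ltW e0)// mulrA.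
  by rewrite -natrM.
have h2 : P * delta + delta = eps.
  by rewrite /delta; field; rewrite gt_eqF.
have h3 : P * rho `^ (- a) = 8 `^ (d%:R + a) * 2 `^ (- a) * r ^+ d.
  rewrite /P /rho mulrA -natrM !powRM ?(ltW r0)//.
  rewrite (@powRD _ r); last by apply/implyP => _; rewrite gt_eqF.
  rewrite [r `^ (- a)]powRN powR_mulrn ?(ltW r0)//.
  by field; rewrite gt_eqF// powR_gt0.
have h4 : (2 * rho) ^+ d = 4 ^+ d * r ^+ d by rewrite /rho mulrA -natrM exprMn.
rewrite h4 /C -/m.
have -> : P * (delta + 2 * m * (C0 * rho `^ (- a))) =
  P * delta + 2 * m * C0 * (P * rho `^ (- a)) by ring.
rewrite h3; lra.
Unshelve. all: by end_near. Qed.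

End weak_harnack.

(** * Consequences for the system *)

Section liouville.
Context {R : realType} {d : nat}.
Local Notation rV := 'rV[R]_d.
Local Notation mu := (@lebesgue_rV R d).
Implicit Types (x y z : rV) (u v G U : rV -> R).

Local Notation ind r := (\1_(eball (0%R : rV) r) : rV -> R).

Lemma ind_ge0 r x : 0 <= ind r x.
Proof. by rewrite indicE. Qed.

Lemma measurable_ind r : measurable_fun setT (ind r).
Proof. by apply: measurable_indic; exact: measurable_eball. Qed.

Lemma indE r x : ind r x = ((enorm x < r)%R)%:R.
Proof. by rewrite indicE; congr (nat_of_bool _)%:R; apply/idP/idP; rewrite inE /eball/= subr0. Qed.

Lemma nbhs_box x (A : set rV) : nbhs x A -> exists2 e : R, 0 < e &
  [set y : rV | forall i, x ord0 i - e < y ord0 i < x ord0 i + e] `<=` A.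
Proof.
move=> /nbhs_ballP[e /= e0 he]; exists e => // y yB.
apply: he; split => // i j; rewrite (ord1 i) /ball/= ltr_distlC; exact: yB.
Qed.

Lemma lebesgue_rV_box_gt0 x (e : R) : 0 < e ->
  (0 < mu [set y : rV | forall i, x ord0 i - e < y ord0 i < x ord0 i + e]%R)%E.
Proof.
move=> e0; rewrite lebesgue_rV_box => [|i]; last by lra.
by rewrite lte_fin prodr_gt0// => i _; lra.
Qed.

(** Testing is done with the cap of radius [2 * r], which is at least 3/4 on the ball of radius [r];
    the resulting integral of [u] over the double ball is the one the weak Harnack inequality bounds
    by [r ^+ d * u x]. *)
Lemma source_le_value (a : R) : (0 < d)%N -> 0 < a < 2 -> exists2 C : R, 0 < C &
  forall r u G, 0 < r -> classical a u -> (forall x, 0 <= u x) ->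
  measurable_fun setT G -> (forall x, 0 <= G x) ->
  (forall x, G x <= frac_laplacian a u x) -> forall x, enorm x <= r ->
  (\int[mu]_y (G y * ind r y)%:E <= (C * r `^ (d%:R - a) * u x)%:E)%E.
Proof.
move=> hd a02.
have [C1 C10 H1] := @integral_source_le R d a a02.
have [C2 C20 H2] := @weak_harnack R d a hd a02.
exists (4 / 3 * C1 * 2 `^ (- a) * C2); first by rewrite !mulr_gt0 ?powR_gt0.
move=> r u G r0 clu u0 mG G0 GL x xr.
have r20 : 0 < 2 * r by rewrite mulr_gt0.
have L0 y : 0 <= frac_laplacian a u y := le_trans (G0 y) (GL y).
have h1 := H1 (2 * r) u G r20 clu u0 mG G0 GL.
have h2 := H2 r u r0 clu u0 L0 x xr.
have mcG : measurable_fun setT (fun y => cap (2 * r) y * G y).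
  by apply: measurable_funM; [exact: measurable_cap|exact: mG].
have cG0 y : 0 <= cap (2 * r) y * G y by rewrite mulr_ge0 ?cap_ge0.
apply: (@le_trans _ _ (\int[mu]_y (4 / 3 * (cap (2 * r) y * G y))%:E)%E).
  apply: le_integralT.
  - by apply: measurable_funM; [exact: mG|exact: measurable_ind].
  - by apply: measurable_funM; [exact: measurable_cst|exact: mcG].
  - move=> y; rewrite mulr_ge0 ?ind_ge0//= indE.
    have [yr|_] := ltP (enorm y) r; last by rewrite mulr0 mulr_ge0// divr_ge0.
    have c34 : 3 / 4 <= cap (2 * r) y.
      by apply: cap_ge34 => //; rewrite mulrAC divff ?mul1r// ltW.
    by rewrite mulr1 mulrA ler_peMl//; lra.
rewrite integralTZl; [|exact: mcG|exact: cG0|by rewrite divr_ge0].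
have C1r0 : 0 <= C1 * (2 * r) `^ (- a) by rewrite mulr_ge0 ?powR_ge0// ltW.
have := le_trans h1 (lee_wpmul2l (_ : (0 <= (C1 * (2 * r) `^ (- a))%:E)%E) h2).
rewrite lee_fin => /(_ C1r0) h3.
apply: (@le_trans _ _ ((4 / 3)%:E * ((C1 * (2 * r) `^ (- a))%:E * (C2 * r ^+ d * u x)%:E))%E).
  by apply: lee_wpmul2l; [rewrite lee_fin divr_ge0|exact: h3].
rewrite -!EFinM lee_fin le_eqVlt; apply/orP; left; apply/eqP.
rewrite powRM ?(ltW r0)// (@powRD _ r); last by apply/implyP => _; rewrite gt_eqF.
by rewrite powR_mulrn ?(ltW r0)//; ring.
Qed.

(** Strong maximum principle: by the weak Harnack inequality a zero at [x0] makes the integral of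
    [u] vanish on a ball chosen to contain [x1], whereas [u] exceeds [u x1 / 2] on a box around
    [x1]. *)
Lemma supersolution_gt0 (a : R) u : (0 < d)%N -> 0 < a < 2 -> classical a u ->
  (forall x, 0 <= u x) -> (forall x, 0 <= frac_laplacian a u x) ->
  (exists x, u x != 0) -> forall x, 0 < u x.
Proof.
move=> hd a02 clu u0 L0 [x1 ux1] x0.
rewrite lt0r u0 andbT; apply/eqP => ux0.
have [cu _ u1] := clu; have mu' := L1_weight_measurable u1.
have [C C0 HC] := @weak_harnack R d a hd a02.
pose r := Num.max (enorm x0) (enorm x1) + 1.
have r0 : 0 < r by rewrite ltr_wpDl// le_max enorm_ge0.
have x0r : enorm x0 <= r by rewrite /r -[leLHS]addr0 lerD// le_max lexx.
have x1r : enorm x1 < 2 * r.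
  have : enorm x1 < r by rewrite ltr_pwDr// le_max lexx orbT.
  by have := enorm_ge0 x1; lra.
have := HC r u r0 clu u0 L0 x0 x0r; rewrite ux0 mulr0 leNgt => /negP; apply.
have ux1p : 0 < u x1 by rewrite lt0r ux1 u0.
have : \forall y \near x1, u x1 / 2 < u y /\ enorm y < 2 * r.
  apply: filterI; last exact: (cvgr_lt _ (@enorm_continuous R d x1) _ x1r).
  apply: (cvgr_gt _ (cu x1)); rewrite ltr_pdivrMr// ltr_pMr// ltr1n//.
move=> /nbhs_box[e e0]; have := lebesgue_rV_box_gt0 x1 e0.
have := measurable_box_rV (fun i => x1 ord0 i - e) (fun i => x1 ord0 i + e).
set B := [set y | _] => mB B0 hB.
apply: (@lt_le_trans _ _ (\int[mu]_y (u x1 / 2 * \1_B y)%:E)%E).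
  rewrite integralTZl; [|exact: measurable_indic|by move=> y; rewrite indicE|by rewrite divr_ge0].
  by rewrite integral_indic// setIT mule_gt0// lte_fin divr_gt0.
apply: le_integralT.
- by apply: measurable_funM; [exact: measurable_cst|exact: measurable_indic].
- by apply: measurable_funM; [exact: mu'|exact: measurable_ind].
- move=> y; rewrite mulr_ge0 ?divr_ge0 ?indicE//=.
  have [|_] := boolP (y \in B); last by rewrite mulr0 mulr_ge0 ?ind_ge0.
  by rewrite inE => /hB[/ltW uy yr]; rewrite -indicE indE yr !mulr1.
Qed.

Lemma liminf_pos_lower_bound (f : rV -> R -> R -> R) U (p q : R) :
  (forall x, 0 < U x) -> liminf_pos f U p q ->
  exists k e : R, [/\ 0 < k, 0 < e & forall x t s, 0 < t < e -> 0 < s < e ->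
    k * (U x * t `^ p * s `^ q) <= f x t s].
Proof.
move=> U0; rewrite /liminf_pos limf_einfE => /ereal_sup_gt[_ [A FA <-] hA].
have [k k0 kA] : exists2 k : R, 0 < k & (k%:E <= ereal_inf [set ereal_inf
    [set (f x ts.1 ts.2 / (U x * ts.1 `^ p * ts.2 `^ q))%:E | x in setT] | ts in A])%E.
  (* The infimum may be [+oo], in which case any positive constant serves. *)
  move: hA; case: (ereal_inf _) => [l|_|//]; last by exists 1 => //; exact: leey.
  by rewrite lte_fin => l0; exists l.
case: FA => -[A1 A2] [/= FA1 FA2] A12.
have [e1 e10 he1] : exists2 e : R, 0 < e & forall t, 0 < t < e -> A1 t.
  move: FA1 => /nbhs_ballP[e /= e0 he]; exists e => // t /andP[t0 te].
  by apply: he => //; rewrite /ball/= sub0r normrN gtr0_norm.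
have [e2 e20 he2] : exists2 e : R, 0 < e & forall t, 0 < t < e -> A2 t.
  move: FA2 => /nbhs_ballP[e /= e0 he]; exists e => // t /andP[t0 te].
  by apply: he => //; rewrite /ball/= sub0r normrN gtr0_norm.
exists k, (Num.min e1 e2); split; [by []|by rewrite lt_min e10|].
move=> x t s /andP[t0]; rewrite lt_min => /andP[te1 te2] /andP[s0].
rewrite lt_min => /andP[se1 se2].
have Ats : A (t, s) by apply: A12; split; [apply: he1|apply: he2]; rewrite ?t0 ?s0.
have : (k%:E <= (f x t s / (U x * t `^ p * s `^ q))%:E)%E.
  apply: (le_trans kA); apply: (@le_trans _ _ (ereal_inf
    [set (f x t s / (U x * t `^ p * s `^ q))%:E | x in setT])).
    by apply: ereal_inf_lbound; exists (t, s).
  by apply: ereal_inf_lbound; exists x.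
by rewrite lee_fin ler_pdivlMr// !mulr_gt0 ?powR_gt0.
Qed.

(** By monotonicity [f] is at least [k * U * A ^ p * B ^ q] on the ball of radius [rho], and this
    function cut off to that ball is an admissible source. The radii [rho] and [r] are kept apart
    for two uses: [rho = 1] gives the decay bound from below, [rho = r] the mass bound. *)
Lemma source_mass_le (a : R) (f : rV -> R -> R -> R) U (p q k e : R) u v :
  (0 < d)%N -> 0 < a < 2 ->
  (forall x t s, 0 <= t -> 0 <= s -> 0 <= f x t s) ->
  (forall x t t' s s', 0 <= t -> t <= t' -> 0 <= s -> s <= s' -> f x t s <= f x t' s') ->
  measurable_fun setT U ->
  (forall x, 0 < U x) -> 0 < k ->
  (forall x t s, 0 < t < e -> 0 < s < e -> k * (U x * t `^ p * s `^ q) <= f x t s) ->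
  classical a u -> (forall x, 0 <= u x) -> (forall x, 0 <= v x) ->
  (forall x, f x (u x) (v x) <= frac_laplacian a u x) ->
  exists2 C : R, 0 < C & forall (rho r A B : R) x,
    0 < r -> rho <= r -> 0 < A < e -> 0 < B < e ->
    (forall y, enorm y < rho -> A <= u y /\ B <= v y) -> enorm x <= r ->
    ((A `^ p * B `^ q)%:E * \int[mu]_y (U y * ind rho y)%:E <=
     (C * r `^ (d%:R - a) * u x)%:E)%E.
Proof.
move=> hd a02 f0 f_le mU U0 k0 hk clu u0 v0 L.
have [C C0 HC] := source_le_value hd a02.
exists (C / k); first by rewrite divr_gt0.
move=> rho r A B x r0 rhor /andP[A0 Ae] /andP[B0 Be] hAB xr.
have AB0 : 0 <= A `^ p * B `^ q by rewrite mulr_ge0 ?powR_ge0.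
pose G y := k * (A `^ p * B `^ q) * (U y * ind rho y).
have mUi : measurable_fun setT (fun y => U y * ind rho y).
  by apply: measurable_funM; [exact: mU|exact: measurable_ind].
have Ui0 y : 0 <= U y * ind rho y by rewrite mulr_ge0 ?ind_ge0// ltW.
have G0 y : 0 <= G y by rewrite mulr_ge0// mulr_ge0// ltW.
have mG : measurable_fun setT G by apply: measurable_funM; [exact: measurable_cst|exact: mUi].
have GL y : G y <= frac_laplacian a u y.
  apply: le_trans (L y); rewrite /G indE.
  have [yr|_] := ltP (enorm y) rho; last by rewrite !mulr0 f0.
  have [Au Bv] := hAB y yr.
  apply: le_trans (f_le y _ _ _ _ (ltW A0) Au (ltW B0) Bv).
  rewrite mulr1; apply: le_trans (hk y A B _ _); rewrite ?A0 ?B0//.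
  by rewrite le_eqVlt; apply/orP; left; apply/eqP; ring.
have := HC r u G r0 clu u0 mG G0 GL x xr.
have -> : (\int[mu]_y (G y * ind r y)%:E = \int[mu]_y (G y)%:E)%E.
  apply: eq_integral => y _; congr EFin; rewrite /G !indE.
  have [yr|_] := ltP (enorm y) rho; last by rewrite !mulr0 mul0r.
  by rewrite (lt_le_trans yr rhor) !mulr1.
rewrite integralTZl; [|exact: mUi|exact: Ui0|by rewrite mulr_ge0// ltW].
move=> h.
have ki0 : (0 <= (k^-1)%:E)%E by rewrite lee_fin invr_ge0 ltW.
have := lee_wpmul2l ki0 h.
rewrite muleA -!EFinM mulKf ?gt_eqF// => /le_trans; apply.
by rewrite lee_fin le_eqVlt; apply/orP; left; apply/eqP; ring.
Qed.

Lemma integral_pos_eball_gt0 U (r : R) : measurable_fun setT U -> (forall x, 0 < U x) ->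
  0 < r -> (0 < \int[mu]_y (U y * ind r y)%:E)%E.
Proof.
move=> mU U0 r0.
have Ui0 y : 0 <= U y * ind r y by rewrite mulr_ge0 ?ind_ge0// ltW.
have mUi : measurable_fun setT (fun y => (U y * ind r y)%:E).
  by apply/measurable_EFinP; apply: measurable_funM; [exact: mU|exact: measurable_ind].
rewrite lt0e integralT_ge0// andbT; apply/eqP => I0.
have : (\int[mu]_y `|(U y * ind r y)%:E| = 0)%E.
  by rewrite -I0; apply: eq_integral => y _; rewrite gee0_abs// lee_fin.
move=> /(ae_eq_integral_abs _ measurableT mUi)[N [mN N0 hN]].
have ballN : eball (0 : rV) r `<=` N.
  move=> y yr; apply: hN => /= /(_ I)[/eqP].
  by rewrite mulf_eq0 (gt_eqF (U0 y))/= indicE mem_set// oner_eq0.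
have e0 : enorm (0 : rV) < r.
  by rewrite /enorm big1 ?sqrtr0// => i _; rewrite mxE expr0n.
have /nbhs_box[e ep hB] : nbhs (0 : rV) [set y | enorm y < r].
  exact: (cvgr_lt _ (@enorm_continuous R d 0) _ e0).
have := lebesgue_rV_box_gt0 0 ep.
rewrite ltNge => /negP; apply; rewrite -N0; apply: le_measure.
- by rewrite inE; exact: measurable_box_rV.
- by rewrite inE.
- by move=> y /hB yr; apply: ballN; rewrite /eball/= subr0.
Qed.

End liouville.

(** * Lower bounds on growth, and the product of the two mass estimates *)

Section conclusion.
Context {R : realType} {d : nat}.
Local Notation rV := 'rV[R]_d.
Local Notation mu := (@lebesgue_rV R d).
Implicit Types (x y z : rV) (u v U : rV -> R).

Local Notation ind r := (\1_(eball (0%R : rV) r) : rV -> R).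

Lemma min_enorm_le (r : R) u : 0 <= r -> continuous u ->
  exists2 x, enorm x <= r & forall y, enorm y <= r -> u x <= u y.
Proof.
move=> r0 cu.
have [||x] := @EVT_min_rV R d u [set x | enorm x <= r] _ (@compact_enorm_le R d r).
- by exists 0; rewrite /= /enorm big1 ?sqrtr0// => i _; rewrite mxE expr0n.
- exact: continuous_subspaceT.
by rewrite inE => xr h; exists x => // y yr; apply: h; rewrite inE.
Qed.

Lemma Phi_ge0 U (r : R) : (forall x, 0 < U x) -> (0 <= Phi U r)%E.
Proof.
move=> U0; apply: le_ereal_inf_tmp => _ [x _ <-].
by apply: integral_ge0 => y _; rewrite lee_fin ltW.
Qed.

Lemma Phi_le U (r : R) : (0 < d)%N -> 0 < r -> measurable_fun setT U ->
  (forall x, 0 < U x) -> (Phi U r <= \int[mu]_y (U y * ind (2 * r) y)%:E)%E.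
Proof.
move=> hd r0 mU U0.
(* One admissible centre is enough: if [enorm x = r] and [enorm (y - x) < r / 4], then [enorm y ^+ 2
   <= 2 * r ^+ 2 + r ^+ 2 / 8 < (2 * r) ^+ 2]. *)
pose x : rV := r *: delta_mx ord0 (Ordinal hd).
have xE : enorm x = r.
  rewrite enormZ gtr0_norm// /enorm (bigD1 (Ordinal hd))//= mxE !eqxx expr1n.
  rewrite big1 ?addr0 ?sqrtr1 ?mulr1// => i iN.
  by rewrite mxE (negbTE iN) andbF expr0n.
apply: (@le_trans _ _ (\int[mu]_(y in eball x (r / 4)) (U y)%:E)%E).
  by apply: ereal_inf_lbound; exists x => //; rewrite /= xE; apply/andP; split; lra.
rewrite integral_mkcond; apply: ge0_le_integral.
- exact: measurableT.
- by move=> y _; rewrite /patch; case: ifP => // _; rewrite lee_fin ltW.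
- apply/(measurable_restrictT _ (measurable_eball _ _)).1.
  by apply/measurable_EFinP; exact: measurable_funTS.
- by apply/measurable_EFinP; apply: measurable_funM; [exact: mU|exact: measurable_ind].
- move=> y _; rewrite /patch; case: ifPn => [|_]; last first.
    by rewrite lee_fin mulr_ge0 ?ind_ge0// ltW.
  rewrite inE /eball/= => yx; rewrite indE.
  suff -> : enorm y < 2 * r by rewrite mulr1.
  rewrite -(@ltr_pXn2r _ 2)// ?nnegrE ?enorm_ge0 ?mulr_ge0 ?(ltW r0)//.
  have := ler_sqr_enormD x (y - x); rewrite subrKC xE.
  have : enorm (y - x) ^+ 2 < (r / 4) ^+ 2.
    by rewrite ltr_pXn2r ?nnegrE ?enorm_ge0 ?divr_ge0 ?(ltW r0).
  by move: r0; move: (enorm (y - x) ^+ 2) (enorm y ^+ 2) => s t; nra.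
Qed.

(** Stated for a single equation with [v] as a parameter, to be applied to each equation of the
    system in turn. *)
Lemma source_growth_mass (a : R) (f : rV -> R -> R -> R) U (p q k e delta : R) u v :
  (0 < d)%N -> 0 < a < 2 -> a < d%:R ->
  (forall x t s, 0 <= t -> 0 <= s -> 0 <= f x t s) ->
  (forall x t t' s s', 0 <= t -> t <= t' -> 0 <= s -> s <= s' -> f x t s <= f x t' s') ->
  measurable_fun setT U -> (forall x, 0 < U x) -> 0 < k ->
  (forall x t s, 0 < t < e -> 0 < s < e -> k * (U x * t `^ p * s `^ q) <= f x t s) ->
  0 < delta < e ->
  classical a u -> (forall x, 0 < u x) -> continuous v -> (forall x, 0 < v x) ->
  (forall x, f x (u x) (v x) <= frac_laplacian a u x) ->
  exists C c : R, [/\ 0 < C, 0 < c,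
    forall r x, 1 <= r -> enorm x <= r -> c * r `^ (a - d%:R) <= Num.min delta (u x) &
    forall (r : R) x z, 0 < r -> enorm x <= r -> enorm z <= r ->
      (forall y, enorm y <= r -> u x <= u y) -> (forall y, enorm y <= r -> v z <= v y) ->
      ((Num.min delta (u x) `^ p * Num.min delta (v z) `^ q)%:E *
          \int[mu]_y (U y * ind r y)%:E <=
        (C * r `^ (d%:R - a) * Num.min delta (u x))%:E)%E].
Proof.
move=> hd a02 ad f0 f_le mU U0 k0 hk /andP[delta0 deltae] clu u0 cv v0 L.
have cu : continuous u by case: clu.
have [C C0 HC] := source_mass_le hd a02 f0 f_le mU U0 k0 hk clu
  (fun x => ltW (u0 x)) (fun x => ltW (v0 x)) L.
have mine (w : rV -> R) x : (forall y, 0 < w y) -> 0 < Num.min delta (w x) < e.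
  by move=> w0; rewrite lt_min delta0 w0/= gt_min deltae.
have [x1 x1r hx1] := min_enorm_le ler01 cu.
have [z1 z1r hz1] := min_enorm_le ler01 cv.
set A1 := Num.min delta (u x1); set B1 := Num.min delta (v z1).
have A1e : 0 < A1 < e := mine u x1 u0.
have B1e : 0 < B1 < e := mine v z1 v0.
have hAB1 y : enorm y < 1 -> A1 <= u y /\ B1 <= v y.
  by move=> /ltW y1; rewrite /A1 /B1 !ge_min hx1// hz1// !orbT.
have AB0 : 0 < A1 `^ p * B1 `^ q.
  by rewrite mulr_gt0// powR_gt0//; [case/andP: A1e|case/andP: B1e].
(* Local integrability of [U] is not assumed; finiteness on the unit ball follows from the mass
   bound itself, whose left factor is positive. *)
have [J J0 JE] : exists2 J : R, 0 < J & (\int[mu]_y (U y * ind 1 y)%:E = J%:E)%E.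
  have := integral_pos_eball_gt0 mU U0 (@ltr01 R).
  have := HC 1 1 A1 B1 x1 ltr01 (lexx _) A1e B1e hAB1 x1r.
  case: (\int[mu]_y _)%E => [J _ J0|h _|//]; first by exists J.
  by move: h; rewrite gt0_muley// lte_fin.
have powV (r : R) : 0 < r -> r `^ (d%:R - a) * r `^ (a - d%:R) = 1.
  move=> r0; rewrite -powRD; last by apply/implyP => _; rewrite gt_eqF.
  by rewrite subrKA subrr powRr0.
(* If the minimum is [delta], then [u x <= u 0 <= K * delta], as [x] minimizes [u] on a ball
   containing 0; otherwise [K >= 1] is enough. *)
pose K := Num.max 1 (u 0 / delta).
have K1 : 1 <= K by rewrite le_max lexx.
have K0 : 0 < K := lt_le_trans ltr01 K1.
exists (C * K), (Num.min delta ((A1 `^ p * B1 `^ q) * J / C)); split.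
- by rewrite mulr_gt0.
- by rewrite lt_min delta0 divr_gt0// mulr_gt0.
- move=> r x r1 xr; have r0 : 0 < r := lt_le_trans ltr01 r1.
  have rp : r `^ (a - d%:R) <= 1.
    by rewrite -[leRHS](powRr0 r) ler_powR// subr_le0 ltW.
  rewrite le_min; apply/andP; split.
    apply: (@le_trans _ _ (delta * r `^ (a - d%:R))).
      by rewrite ler_wpM2r ?powR_ge0// ge_min lexx.
    by rewrite ler_piMr// ltW.
  have := HC 1 r A1 B1 x r0 r1 A1e B1e hAB1 xr.
  rewrite JE -EFinM lee_fin => h.
  apply: (@le_trans _ _ ((A1 `^ p * B1 `^ q) * J / C * r `^ (a - d%:R))).
    by rewrite ler_wpM2r ?powR_ge0// ge_min lexx orbT.
  rewrite mulrAC ler_pdivrMr//.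
  have := ler_wpM2r (powR_ge0 r (a - d%:R)) h.
  have := powV r r0; move: (r `^ (d%:R - a)) (r `^ (a - d%:R)) => s t st.
  rewrite (_ : C * s * u x * t = C * u x * (s * t)); last by ring.
  by rewrite st mulr1 [leRHS]mulrC.
- move=> r x z r0 xr zr hx hz.
  have hAB y : enorm y < r -> Num.min delta (u x) <= u y /\ Num.min delta (v z) <= v y.
    by move=> /ltW yr; rewrite !ge_min hx// hz// !orbT.
  apply: le_trans (HC r r _ _ x r0 (lexx _) (mine u x u0) (mine v z v0) hAB xr) _.
  rewrite lee_fin -!mulrA ler_pM2l// mulrCA ler_wpM2l ?powR_ge0//.
  have [ud|ud] := leP delta (u x); last by rewrite ler_peMl// ltW.
  have : u x <= u 0.
    by apply: hx; rewrite /enorm big1 ?sqrtr0 ?ltW// => i _; rewrite mxE expr0n.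
  move=> /le_trans; apply; rewrite -ler_pdivrMr// le_max lexx orbT//.
Qed.

(** Multiplying the mass bounds and dividing by [A * B] leaves [A ^ s1 * B ^ s2] on the left. Since
    [p1] and [q2] are at least 1, both exponents are nonnegative and the lower bounds on [A] and [B]
    may be inserted; [(n - al) * (1 + s1)] is the [(n - al) * (p1 + q1)] of the conclusion. *)
Lemma source_product_le (al be p1 p2 q1 q2 A B P Q K1 K2 c1 c2 r n : R) :
  1 <= p1 -> 0 <= p2 -> 0 <= q1 -> 1 <= q2 -> 0 < A -> 0 < B -> 0 <= P -> 0 <= Q ->
  0 < K1 -> 0 < K2 -> 0 < c1 -> 0 < c2 -> 0 < r ->
  A `^ p1 * B `^ p2 * P <= K1 * r `^ (n - al) * A ->
  B `^ q2 * A `^ q1 * Q <= K2 * r `^ (n - be) * B ->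
  c1 * r `^ (al - n) <= A -> c2 * r `^ (be - n) <= B ->
  P * Q <= K1 * K2 / (c1 `^ (p1 + q1 - 1) * c2 `^ (p2 + q2 - 1)) *
    r `^ ((n - al) * (p1 + q1) + (n - be) * (p2 + q2)).
Proof.
move=> hp1 hp2 hq1 hq2 A0 B0 P0 Q0 K10 K20 c10 c20 r0 hP hQ hA hB.
set s1 := p1 + q1 - 1; set s2 := p2 + q2 - 1.
have s10 : 0 <= s1 by rewrite /s1; lra.
have s20 : 0 <= s2 by rewrite /s2; lra.
have PD (t x y : R) : 0 < t -> t `^ (x + y) = t `^ x * t `^ y.
  by move=> t0; rewrite powRD//; apply/implyP => _; rewrite gt_eqF.
have EA : A `^ p1 * A `^ q1 = A `^ s1 * A.
  rewrite -PD// (_ : p1 + q1 = s1 + 1); last by rewrite /s1; ring.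
  by rewrite PD// powRr1// ltW.
have EB : B `^ p2 * B `^ q2 = B `^ s2 * B.
  rewrite -PD// (_ : p2 + q2 = s2 + 1); last by rewrite /s2; ring.
  by rewrite PD// powRr1// ltW.
have hPQ : A `^ s1 * B `^ s2 * (P * Q) <= K1 * K2 * (r `^ (n - al) * r `^ (n - be)).
  rewrite -(@ler_pM2r _ (A * B)) ?mulr_gt0//.
  have := ler_pM _ _ hP hQ.
  rewrite !mulr_ge0 ?powR_ge0// => /(_ isT isT).
  rewrite (_ : _ * _ * P * _ = (A `^ p1 * A `^ q1) * (B `^ p2 * B `^ q2) * (P * Q)); last by ring.
  by rewrite EA EB => h; apply: le_trans (le_trans _ h) _; rewrite le_eqVlt; apply/orP; left; apply/eqP; ring.
have lowA : c1 `^ s1 * r `^ ((al - n) * s1) <= A `^ s1.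
  rewrite powRrM -powRM ?powR_ge0 ?(ltW c10)//.
  by apply: ge0_ler_powR; rewrite ?nnegrE ?mulr_ge0 ?powR_ge0 ?(ltW c10) ?(ltW A0).
have lowB : c2 `^ s2 * r `^ ((be - n) * s2) <= B `^ s2.
  rewrite powRrM -powRM ?powR_ge0 ?(ltW c20)//.
  by apply: ge0_ler_powR; rewrite ?nnegrE ?mulr_ge0 ?powR_ge0 ?(ltW c20) ?(ltW B0).
have low : c1 `^ s1 * c2 `^ s2 * (r `^ ((al - n) * s1) * r `^ ((be - n) * s2)) <=
    A `^ s1 * B `^ s2.
  apply: le_trans (ler_pM _ _ lowA lowB); rewrite ?mulr_ge0 ?powR_ge0//.
  by rewrite le_eqVlt; apply/orP; left; apply/eqP; ring.
have c0 : 0 < c1 `^ s1 * c2 `^ s2 by rewrite mulr_gt0 ?powR_gt0.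
have h := le_trans (ler_wpM2r (mulr_ge0 P0 Q0) low) hPQ.
rewrite mulrAC ler_pdivlMr//.
have E0 : 0 < r `^ ((al - n) * s1) * r `^ ((be - n) * s2) by rewrite mulr_gt0 ?powR_gt0.
rewrite -(ler_pM2r E0).
have -> : K1 * K2 * r `^ ((n - al) * (p1 + q1) + (n - be) * (p2 + q2)) *
    (r `^ ((al - n) * s1) * r `^ ((be - n) * s2)) =
    K1 * K2 * (r `^ (n - al) * r `^ (n - be)).
  rewrite -mulrA -!PD//; congr (_ * _ `^ _); rewrite /s1 /s2; ring.
by apply: le_trans h; rewrite le_eqVlt; apply/orP; left; apply/eqP; ring.
Qed.

End conclusion.

Theorem theorem2p2 (R : realType) (d : nat) (hd : (1 <= d)%N)
  (alpha beta : R)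
  (halpha : 0 < alpha < Num.min 2 d%:R) (hbeta : 0 < beta < Num.min 2 d%:R)
  (f g : 'rV[R]_d -> R -> R -> R)
  (hf : nonlinearity f) (hg : nonlinearity g)
  (p1 p2 q1 q2 : R)
  (hp2 : 0 <= p2) (hq1 : 0 <= q1) (hp1 : 1 <= p1) (hq2 : 1 <= q2)
  (U V : 'rV[R]_d -> R)
  (mU : measurable_fun setT U) (mV : measurable_fun setT V)
  (hU : forall x, 0 < U x) (hV : forall x, 0 < V x)
  (hfU : liminf_pos f U p1 p2) (hgV : liminf_pos g V q1 q2)
  (hlim : (maxe ((r `^ (d%:R - alpha))%:E / Phi U r `^ p1^-1)
          (maxe ((r `^ (d%:R - beta))%:E / Phi V r `^ q2^-1)
                ((r `^ ((p1 + p2 + q1 + q2) * d%:R) /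
                  (r `^ (alpha * (p1 + q1)) * r `^ (beta * (p2 + q2))))%:E
                 / (Phi U r * Phi V r)))
          @[r --> +oo%R] --> 0)%E)
  (u v : 'rV[R]_d -> R) (huv : supersolution alpha beta f g u v) :
  (forall x, u x = 0) \/ (forall x, v x = 0).
Proof.
move: halpha hbeta; rewrite !lt_min => /andP[a0 /andP[a2 ad]] /andP[b0 /andP[b2 bd]].
have a02 : 0 < alpha < 2 by rewrite a0.
have b02 : 0 < beta < 2 by rewrite b0.
case: huv => clu clv Lu Lv uv0.
have u0 x : 0 <= u x := (uv0 x).1.
have v0 x : 0 <= v x := (uv0 x).2.
have [f0 _ _ f1 f2] := hf; have [g0 _ _ g1 g2] := hg.
have [uN0|/forallNP uE0] := pselect (exists x, u x != 0); last first.
  by left => x; apply/eqP/negPn/negP; exact: uE0.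
have [vN0|/forallNP vE0] := pselect (exists x, v x != 0); last first.
  by right => x; apply/eqP/negPn/negP; exact: vE0.
exfalso.
have up : forall x, 0 < u x.
  apply: (supersolution_gt0 hd a02 clu u0 _ uN0) => x.
  exact: le_trans (f0 _ _ _ (u0 x) (v0 x)) (Lu x).
have vp : forall x, 0 < v x.
  apply: (supersolution_gt0 hd b02 clv v0 _ vN0) => x.
  exact: le_trans (g0 _ _ _ (u0 x) (v0 x)) (Lv x).
have cu : continuous u by case: clu.
have cv : continuous v by case: clv.
have [k1 [e1 [k10 e10 hk1]]] := liminf_pos_lower_bound hU hfU.
have [k2 [e2 [k20 e20 hk2]]] := liminf_pos_lower_bound hV hgV.
pose e := Num.min e1 e2; have e0 : 0 < e by rewrite lt_min e10.
pose delta := e / 2; have de : 0 < delta < e by rewrite /delta; apply/andP; split; lra.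
have e_lt t : 0 < t < e -> 0 < t < e1 /\ 0 < t < e2.
  by move=> /andP[t0]; rewrite lt_min t0 => /andP[-> ->].
have f_le x t t' s s' : 0 <= t -> t <= t' -> 0 <= s -> s <= s' -> f x t s <= f x t' s'.
  move=> t0 tt' s0 ss'; apply: le_trans (f2 _ _ _ _ (le_trans t0 tt') s0 ss'); exact: f1.
have g_le x t t' s s' : 0 <= t -> t <= t' -> 0 <= s -> s <= s' -> g x s t <= g x s' t'.
  move=> t0 tt' s0 ss'; apply: le_trans (g1 _ _ _ _ s0 ss' (le_trans t0 tt')); exact: g2.
have [C1 [c1 [C10 c10 growth_u mass_u]]] : exists C c : R, _ :=
  @source_growth_mass R d alpha f U p1 p2 k1 e delta u v hd a02 ad f0 f_le mU hU k10
    (fun x t s ht hs => hk1 x t s (e_lt t ht).1 (e_lt s hs).1) de clu up cv vp Lu.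
(* For the second equation the unknown [v] comes first, so the arguments of [g] are exchanged and
   the exponents appear as [q2], [q1]. *)
have hk2' x t s : 0 < t < e -> 0 < s < e -> k2 * (V x * t `^ q2 * s `^ q1) <= g x s t.
  by move=> /e_lt[_ te] /e_lt[_ se]; have := hk2 x s t se te; rewrite mulrAC.
have [C2 [c2 [C20 c20 growth_v mass_v]]] :=
  @source_growth_mass R d beta (fun x t s => g x s t) V q2 q1 k2 e delta v u hd b02 bd
    (fun x t s t0 s0 => g0 x s t s0 t0) g_le mV hV k20 hk2' de clv vp cu up Lv.
pose n : R := d%:R.
pose theta := (n - alpha) * (p1 + q1) + (n - beta) * (p2 + q2).
(* The factor [2 ^ theta] arises because the estimates are taken on the ball of radius [2 * r],
   which contains the balls seen by [Phi] at [r]. *)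
pose D := C1 * C2 / (c1 `^ (p1 + q1 - 1) * c2 `^ (p2 + q2 - 1)) * 2 `^ theta.
have D0 : 0 < D by rewrite !mulr_gt0 ?invr_gt0 ?mulr_gt0 ?powR_gt0.
have D20 : (0 < ((2 * D)^-1)%:E)%E by rewrite lte_fin invr_gt0 mulr_gt0.
have /hlim : nbhs (0%E : \bar R) [set y | (y < ((2 * D)^-1)%:E)%E].
  by apply: open_nbhs_nbhs; split; [exact: open_ereal_lt_ereal|].
(* Below the threshold [1 / (2 * D)] the third quantity gives [2 * D * r ^ theta < P * Q], against
   the bound [P * Q <= D * r ^ theta]. *)
move=> small; near (pinfty_nbhs R) => r.
have r1 : 1 <= r by near: r; apply: nbhs_pinfty_ge; rewrite num_real.
have r0 : 0 < r := lt_le_trans ltr01 r1.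
have : ((r `^ ((p1 + p2 + q1 + q2) * d%:R) /
         (r `^ (alpha * (p1 + q1)) * r `^ (beta * (p2 + q2))))%:E
         / (Phi U r * Phi V r) < ((2 * D)^-1)%:E)%E.
  have : (maxe ((r `^ (d%:R - alpha))%:E / Phi U r `^ p1^-1)
          (maxe ((r `^ (d%:R - beta))%:E / Phi V r `^ q2^-1)
                ((r `^ ((p1 + p2 + q1 + q2) * d%:R) /
                  (r `^ (alpha * (p1 + q1)) * r `^ (beta * (p2 + q2))))%:E
                 / (Phi U r * Phi V r))) < ((2 * D)^-1)%:E)%E.
    by near: r; exact: small.
  by rewrite !gt_max => /andP[_ /andP[_ ->]].
have -> : r `^ ((p1 + p2 + q1 + q2) * d%:R) /
    (r `^ (alpha * (p1 + q1)) * r `^ (beta * (p2 + q2))) = r `^ theta.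
  have PD x y : r `^ (x + y) = r `^ x * r `^ y.
    by rewrite powRD//; apply/implyP => _; rewrite gt_eqF.
  by rewrite -PD -powRN -PD; congr (_ `^ _); rewrite /theta /n; ring.
have rho0 : 0 < 2 * r by rewrite mulr_gt0.
have rho1 : 1 <= 2 * r by lra.
have [x xr hx] := min_enorm_le (ltW rho0) cu.
have [z zr hz] := min_enorm_le (ltW rho0) cv.
have massU := mass_u (2 * r) x z rho0 xr zr hx hz.
have massV := mass_v (2 * r) z x rho0 zr xr hz hx.
have lowA := growth_u (2 * r) x rho1 xr.
have lowB := growth_v (2 * r) z rho1 zr.
move: massU massV lowA lowB; set A := Num.min delta (u x); set B := Num.min delta (v z).
have A0 : 0 < A by rewrite lt_min up andbT; case/andP: de.
have B0 : 0 < B by rewrite lt_min vp andbT; case/andP: de.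
move=> massU massV lowA lowB.
have AB0 : 0 < A `^ p1 * B `^ p2 by rewrite mulr_gt0 ?powR_gt0.
have BA0 : 0 < B `^ q2 * A `^ q1 by rewrite mulr_gt0 ?powR_gt0.
have AB0E : (0 <= (A `^ p1 * B `^ p2)%:E)%E by rewrite lee_fin ltW.
have BA0E : (0 <= (B `^ q2 * A `^ q1)%:E)%E by rewrite lee_fin ltW.
have := le_trans (lee_wpmul2l AB0E (Phi_le hd r0 mU hU)) massU.
(* An infinite [Phi U r] would make the left-hand side of the mass bound infinite. *)
have := Phi_ge0 r hU; case: (Phi U r) => [P P0 hP|_|//]; last first.
  by rewrite gt0_muley ?lte_fin.
have := le_trans (lee_wpmul2l BA0E (Phi_le hd r0 mV hV)) massV.
have := Phi_ge0 r hV; case: (Phi V r) => [Q Q0 hQ|_|//]; last first.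
  by rewrite gt0_muley ?lte_fin.
rewrite -!EFinM !lee_fin in Q0 P0 hQ hP *.
have PQ := source_product_le hp1 hp2 hq1 hq2 A0 B0 P0 Q0 C10 C20 c10 c20 rho0 hP hQ lowA lowB.
have {}PQ : P * Q <= D * r `^ theta.
  apply: (le_trans PQ); rewrite powRM ?(ltW r0)// -/theta /D -!mulrA.
  by rewrite le_eqVlt; apply/orP; left; apply/eqP; ring.
have X0 : 0 < r `^ theta by rewrite powR_gt0.
(* With the convention 1/0 = [+oo], a vanishing product would make the quotient infinite, so it
   cannot lie below the threshold. *)
rewrite inver; case: eqP => [_|/eqP PQN0].
  by rewrite gt0_muley ?lte_fin.
have PQ0 : 0 < P * Q by rewrite lt0r PQN0 mulr_ge0.
rewrite -EFinM lte_fin ltr_pdivrMr// => h.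
have : 2 * D * r `^ theta < P * Q.
  by rewrite -ltr_pdivlMl// mulr_gt0.
by have := mulr_gt0 D0 X0; lra.
Unshelve. all: by end_near. Qed.
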